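(* Let $a<b$ be real numbers and let $U=(a,b)$. Let $m\ge 2$ be a real number and let $a_1,a_2$ be positive real numbers with $a_1\le a_2$. Let $\mathbf{f}\in C([0,\infty);L^2(U))$ satisfy $\mathbf{f}(t)\equiv 0$ for all $t\in[0,\infty)$. Let $F:\mathbb{R}\to\mathbb{R}$ be a continuous function such that $F(z)z\ge 0$ for all $z\in\mathbb{R}$ and $$|a_1(z+|z|^{m-2}z)|\le |F(z)|\le |a_2(z+|z|^{m-2}z)|\quad\text{for all } z\in\mathbb{R}.$$ Let $G:\mathbb{R}\to\mathbb{R}$ be the function $G\equiv 0$. Let $u_0\in H^4_*(U)$ and $u_1\in H^2_*(U)$. If there exists a unique global pseudo classical solution $\mathbf{u}(t)$ of the initial/boundary value problem $$\begin{aligned}& u_{tt}+u_{xxxx}+F(u_t)+G(u)=f(x,t), && (x,t)\in(a,b)\times(0,\infty),\\ & u(a,t)=0=u(b,t), && t\in(0,\infty),\\ & u_{xx}(a,t)=0=u_{xx}(b,t), && t\in(0,\infty),\\ & u(x,0)=u_0(x),\quad u_t(x,0)=u_1(x), && x\in(a,b),\end{aligned}$$ where $f(x,t)=[\mathbf{f}(t)](x)$, then $\|\mathbf{u}(t)\|_{H^2_*(U)}$ exhibits exponential decay and $\|\mathbf{u}'(t)\|_{L^2(U)}$ exhibits exponential decay.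
   Context: All functions are real-valued. For $U=(a,b)$ a bounded open interval, $H^k(U)$ is the usual $L^2$-based Sobolev space and $H^1_0(U)$ is the closure of $C_c^\infty(U)$ in $H^1(U)$. $H^2_*(U):=H^1_0(U)\cap H^2(U)$, equipped with the inner product $(u,v)_{H^2_*}=\int_U u_{xx}v_{xx}\,dx$, with associated norm $\|\cdot\|_{H^2_*(U)}$. $H^4_*(U)$ is the set of $u\in H^4(U)$ such that $u\in H^2_*(U)$ and $u_{xx}\in H^2_*(U)$, equipped with the inner product $(u,v)_{H^4_*}=\int_U u_{xxxx}v_{xxxx}\,dx$. Both are Hilbert spaces. $L$ is the $L^2(U)$-valued operator $L u=u_{xxxx}$ with domain $H^4_*(U)$. Given functions $F,G:\mathbb{R}\to\mathbb{R}$, $\mathbf{f}\in C([0,\infty);L^2(U))$, $u_0\in H^4_*(U)$ and $u_1\in H^2_*(U)$, a global pseudo classical solution of the initial/boundary value problem is a function $\mathbf{u}:[0,\infty)\to L^2(U)$ such that $\mathbf{u}\in C([0,\infty),H^4_*(U))$, $\mathbf{u}\in C^1([0,\infty),H^2_*(U))$, $\mathbf{u}\in C^2([0,\infty),L^2(U))$, $\mathbf{u}(0)=u_0$, $\mathbf{u}'(0)=u_1$, and for all $\phi\in C_c^\infty(0,\infty)$ and all $v\in L^2(U)$, $$\int_0^\infty(\mathbf{u}''(t),v)_{L^2}\phi(t)\,dt=-\int_0^\infty\big[(L(\mathbf{u}(t)),v)_{L^2}+(F(\mathbf{u}'(t)),v)_{L^2}+(G(\mathbf{u}(t)),v)_{L^2}-(\mathbf{f}(t),v)_{L^2}\big]\phi(t)\,dt,$$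 where $F(\mathbf{u}'(t))$ and $G(\mathbf{u}(t))$ denote the compositions $x\mapsto F([\mathbf{u}'(t)](x))$ and $x\mapsto G([\mathbf{u}(t)](x))$. A nonnegative function $g$ on $[0,\infty)$ exhibits exponential decay if there exist constants $C>0$ and $r>0$ such that $g(t)\le Ce^{-rt}$ for all $t\ge 0$. *)

(* Defs.v *)
From mathcomp Require Import all_boot all_order all_algebra.
From mathcomp Require Import all_classical all_reals all_analysis.

Set Implicit Arguments.
Unset Strict Implicit.
Unset Printing Implicit Defensive.

Import Order.TTheory GRing.Theory Num.Theory.
Import numFieldNormedType.Exports.

Local Open Scope classical_set_scope.
Local Open Scope ring_scope.

(* Elements of L^2(U) are handled through representatives R -> R, of which only
   the values on U matter; a time-dependent element is a map R -> (R -> R), of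
   which only the values at t >= 0 matter. Every notion below is invariant under
   almost everywhere equality on U of representatives. *)

Section Sobolev.
Context {R : realType}.
Implicit Types (U : set R) (f g u v w phi : R -> R).

Local Notation leb := (@lebesgue_measure R).

Definition ae_eq_on U u v : Prop := u = v %[ae leb in U].

(* C_c^oo(U) for U open; the elements are extended by 0 to the whole line. *)
Definition test_function U : set (R -> R) :=
  [set phi | [/\ forall (n : nat) (x : R), derivable (derive1n n phi) x 1,
                 compact (closure [set x | phi x != 0]) &
                 closure [set x | phi x != 0] `<=` U]].

(* A subspace of L^2(U) together with its inner product. *)
Record ip_space := IPSpace {
  carrier :> (R -> R) -> Prop ;
  dot : (R -> R) -> (R -> R) -> R }.

Definition norm (X : ip_space) u : R := Num.sqrt (dot X u u).

Definition L2 U : ip_space :=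
  IPSpace [set f | f \_ U \in Lfun leb 2%:E]
          (fun f g => \int[leb]_(x in U) (f x * g x)).

Definition weak_derivative U (k : nat) u w : Prop :=
  forall phi, test_function U phi ->
    \int[leb]_(x in U) (u x * derive1n k phi x) =
    (-1) ^+ k * \int[leb]_(x in U) (w x * phi x).

(* The weak derivative of order k of u, when it exists in L^2(U). *)
Definition wderiv U (k : nat) u : R -> R :=
  xget (cst 0) [set w | L2 U w /\ weak_derivative U k u w].

Definition Hk U (k : nat) : set (R -> R) :=
  [set u | L2 U u /\
     forall j : nat, (j <= k)%N ->
       exists w, L2 U w /\ weak_derivative U j u w].

Definition H1 U : ip_space :=
  IPSpace (Hk U 1)
    (fun u v => dot (L2 U) u v + dot (L2 U) (wderiv U 1 u) (wderiv U 1 v)).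

Definition H10 U : set (R -> R) :=
  [set u | H1 U u /\
     forall e : R, 0 < e ->
       exists phi, test_function U phi /\ norm (H1 U) (u \- phi) < e].

Definition H2star U : ip_space :=
  IPSpace (H10 U `&` Hk U 2)
    (fun u v => \int[leb]_(x in U) (wderiv U 2 u x * wderiv U 2 v x)).

Definition H4star U : ip_space :=
  IPSpace [set u | [/\ Hk U 4 u, H2star U u & H2star U (wderiv U 2 u)]]
    (fun u v => \int[leb]_(x in U) (wderiv U 4 u x * wderiv U 4 v x)).

(* The operator u |-> u_xxxx, with domain H4star U. *)
Definition L U u : R -> R := wderiv U 4 u.

End Sobolev.

Section TimeDependent.
Context {R : realType}.
Implicit Types (X : @ip_space R) (U : set R) (u : R -> R -> R).

(* u \in C([0, +oo), X) *)
Definition C0 X u : Prop :=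
  forall t : R, 0 <= t ->
    X (u t) /\
    norm X (u s \- u t) @[s --> within [set s : R | 0 <= s] (nbhs t)] --> 0.

(* g is the derivative of u at t, as a map from [0, +oo) to X; the derivative is
   one-sided at t = 0. *)
Definition has_derivative X u (t : R) (g : R -> R) : Prop :=
  X g /\
  norm X (fun x => (u s x - u t x) / (s - t) - g x)
    @[s --> within [set s : R | 0 <= s /\ s != t] (nbhs t)] --> 0.

(* u \in C^k([0, +oo), X) *)
Fixpoint Ck X (k : nat) u : Prop :=
  C0 X u /\
  match k with
  | 0%N => True
  | k'.+1 => exists u' : R -> R -> R,
      (forall t : R, 0 <= t -> has_derivative X u t (u' t)) /\ Ck X k' u'
  end.

(* The derivative u' of u : [0, +oo) -> L^2(U). *)
Definition Dt U u : R -> R -> R :=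
  fun t => xget (cst 0) [set g | has_derivative (L2 U) u t g].

Definition pseudo_classical_solution U (F G : R -> R) (f : R -> R -> R)
    (u0 u1 : R -> R) u : Prop :=
  [/\ C0 (H4star U) u, Ck (H2star U) 1 u & Ck (L2 U) 2 u] /\
  [/\ ae_eq_on U (u 0) u0,
      ae_eq_on U (Dt U u 0) u1 &
      forall phi v : R -> R, test_function `]0, +oo[ phi -> L2 U v ->
        \int[@lebesgue_measure R]_(t in `]0, +oo[)
          (dot (L2 U) (Dt U (Dt U u) t) v * phi t) =
        - \int[@lebesgue_measure R]_(t in `]0, +oo[)
          ((dot (L2 U) (L U (u t)) v + dot (L2 U) (F \o Dt U u t) v
            + dot (L2 U) (G \o u t) v - dot (L2 U) (f t) v) * phi t)].

(* Two solutions are the same when they agree as maps from [0, +oo) to L^2(U). *)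
Definition unique_pseudo_classical_solution U (F G : R -> R) (f : R -> R -> R)
    (u0 u1 : R -> R) u : Prop :=
  pseudo_classical_solution U F G f u0 u1 u /\
  forall w, pseudo_classical_solution U F G f u0 u1 w ->
    forall t : R, 0 <= t -> ae_eq_on U (w t) (u t).

Definition exponential_decay (g : R -> R) : Prop :=
  exists C r : R, [/\ 0 < C, 0 < r &
    forall t : R, 0 <= t -> g t <= C * expR (- r * t)].

End TimeDependent.

(* Main.v *)
(* Testing the equation with v = u' gives E' = -D for the energy
   E = (|u'|^2 + |u_xx|^2) / 2 and the dissipation D = (F(u'), u') >= a1 |u'|^2.
   Testing it with v = u, the cross term p = (u', u) satisfies
   p' = |u'|^2 - |u_xx|^2 - (F(u'), u). Since E decreases and H2star embeds in
   L^oo, u is bounded by some M uniformly in time, and splitting according to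
   |u'| <= 1 or |u'| > 1,
     |(F(u'), u)| <= 2 a2 |u'| |u| + M D.
   Hence V = E + eps p, which is comparable to E for small eps, satisfies
   V' <= -c V.

   The equation is only given weakly in time; it holds at each t > 0 because all
   its terms are continuous in t. The identity (u_xxxx, v) = (u_xx, v_xx) on
   H4star x H2star follows by approximating the factor in H10 by test functions. *)

Require Import Defs.
From mathcomp Require Import all_boot all_order all_algebra.
From mathcomp Require Import all_classical all_reals all_analysis.
From mathcomp Require Import measurable_realfun ring lra.

Set Implicit Arguments.
Unset Strict Implicit.
Unset Printing Implicit Defensive.

Import Order.TTheory GRing.Theory Num.Theory.
Import numFieldNormedType.Exports.

Local Open Scope classical_set_scope.
Local Open Scope ring_scope.

(** * Semi-inner products *)

Section PreHilbert.
Context {R : realType}.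
Implicit Types (X : @ip_space R) (u v w : R -> R).

(** Functions are representatives, and [wderiv] and [Dt] select arbitrary witnesses, so weak
    derivatives are linear only almost everywhere. [pre_hilbert] is the matching interface: its laws
    concern members of the space only and omit definiteness. It is instantiated for [L2], [H1] and
    [H2star], and yields Cauchy-Schwarz, continuity of the inner product and a product rule once for
    all. No trace at the endpoints is taken: vanishing at [a] and [b] enters only through density of
    test functions. The growth of [F] is the main obstacle: for large [m], [F(u')] is not controlled
    by the L^2 norm of [u']. Where [|u'| > 1], however, [|F(u')| <= F(u') u'], so a bounded factor
    [u] lets the dissipation absorb the cross term. The bound on [u] comes from the initial energy,
    on which [eps] and the decay rate therefore depend. The equation has to be tested with functions
    that vary with time. This is legitimate because continuity gives it at every [t > 0] for every
    fixed test function, with no exceptional null set of times depending on that function. *)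

Record pre_hilbert X : Prop := PreHilbert {
  ph_lin : forall (c : R) u v, X u -> X v -> X (fun x => c * u x + v x) ;
  ph_sym : forall u v, X u -> X v -> dot X u v = dot X v u ;
  ph_dotl : forall (c : R) u v w, X u -> X v -> X w ->
    dot X (fun x => c * u x + v x) w = c * dot X u w + dot X v w ;
  ph_ge0 : forall u, X u -> 0 <= dot X u u }.

Context {X : @ip_space R} (hX : pre_hilbert X).

Lemma ph_add u v : X u -> X v -> X (fun x => u x + v x).
Proof.
move=> Xu Xv; have := ph_lin hX 1 Xu Xv.
by under eq_fun do rewrite mul1r.
Qed.

Lemma ph_sub u v : X u -> X v -> X (u \- v).
Proof.
move=> Xu Xv; have := ph_lin hX (-1) Xv Xu; congr (carrier X _).
by apply/funext => x /=; ring.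
Qed.

Lemma ph_scale (c : R) u : X u -> X (fun x => c * u x).
Proof.
move=> Xu; have := ph_lin hX (c - 1) Xu Xu; congr (carrier X _).
by apply/funext => x /=; ring.
Qed.

Lemma dotDl u v w : X u -> X v -> X w ->
  dot X (fun x => u x + v x) w = dot X u w + dot X v w.
Proof.
move=> Xu Xv Xw; have := ph_dotl hX 1 Xu Xv Xw.
by under eq_fun do rewrite mul1r; rewrite mul1r.
Qed.

Lemma dotBl u v w : X u -> X v -> X w ->
  dot X (u \- v) w = dot X u w - dot X v w.
Proof.
move=> Xu Xv Xw; rewrite (_ : u \- v = fun x => -1 * v x + u x).
  by rewrite (ph_dotl hX)//; ring.
by apply/funext => x /=; ring.
Qed.

Lemma dotZl (c : R) u w : X u -> X w -> dot X (fun x => c * u x) w = c * dot X u w.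
Proof.
move=> Xu Xw; rewrite (_ : (fun x => _) = fun x => (c - 1) * u x + u x).
  by rewrite (ph_dotl hX)//; ring.
by apply/funext => x /=; ring.
Qed.

Lemma dotDr u v w : X u -> X v -> X w ->
  dot X w (fun x => u x + v x) = dot X w u + dot X w v.
Proof.
move=> Xu Xv Xw; rewrite (ph_sym hX)//; last exact: ph_add.
by rewrite dotDl// (ph_sym hX Xu)// (ph_sym hX Xv).
Qed.

Lemma dotBr u v w : X u -> X v -> X w ->
  dot X w (u \- v) = dot X w u - dot X w v.
Proof.
move=> Xu Xv Xw; rewrite (ph_sym hX)//; last exact: ph_sub.
by rewrite dotBl// (ph_sym hX Xu)// (ph_sym hX Xv).
Qed.

Lemma dotZr (c : R) u w : X u -> X w -> dot X w (fun x => c * u x) = c * dot X w u.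
Proof.
move=> Xu Xw; rewrite (ph_sym hX)//; last exact: ph_scale.
by rewrite dotZl// (ph_sym hX Xu).
Qed.

Lemma dot_lin2 (c : R) u v w z : X u -> X v -> X w -> X z ->
  dot X (fun x => c * u x + v x) (fun x => c * w x + z x) =
  c ^+ 2 * dot X u w + c * (dot X u z + dot X v w) + dot X v z.
Proof.
move=> Xu Xv Xw Xz; rewrite (ph_dotl hX)//; last exact: (ph_lin hX).
have Xcw := ph_scale c Xw.
by rewrite (dotDr Xcw Xz Xu) (dotDr Xcw Xz Xv) !dotZr//; ring.
Qed.

Lemma sqr_norm u : X u -> norm X u ^+ 2 = dot X u u.
Proof. by move=> Xu; rewrite sqr_sqrtr// (ph_ge0 hX). Qed.

Lemma ph_norm_ge0 u : 0 <= norm X u.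
Proof. exact: sqrtr_ge0. Qed.

Lemma cauchy_schwarz_sqr u v : X u -> X v ->
  dot X u v ^+ 2 <= dot X u u * dot X v v.
Proof.
move=> Xu Xv.
have q (t : R) : 0 <= t ^+ 2 * dot X u u + 2 * t * dot X u v + dot X v v.
  have := ph_ge0 hX (ph_lin hX t Xu Xv).
  rewrite (ph_dotl hX)//; last exact: (ph_lin hX).
  rewrite !(dotDr (ph_scale t Xu))// !dotZr// (ph_sym hX Xv Xu).
  by congr (0 <= _); ring.
have A0 := ph_ge0 hX Xu; move: A0 q.
set A := dot X u u; set B := dot X u v; set C := dot X v v => A0 q.
have [A1|A1] := eqVneq A 0.
  have [->|B0] := eqVneq B 0; first by rewrite A1 mul0r expr0n.
  (* With [A = 0] and [B != 0] the quadratic is affine and takes the value -1 at this point. *)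
  have := q (- (C + 1) / (2 * B)); rewrite A1 mulr0 add0r.
  rewrite (_ : 2 * _ * B = - (C + 1)); first by lra.
  by field.
have A2 : 0 < A by rewrite lt_neqAle eq_sym A1.
(* Evaluation at the minimizer of the quadratic. *)
have := q (- B / A); rewrite (_ : _ + C = (A * C - B ^+ 2) / A).
  by rewrite pmulr_lge0 ?invr_gt0// subr_ge0.
by field.
Qed.

Lemma cauchy_schwarz u v : X u -> X v -> `|dot X u v| <= norm X u * norm X v.
Proof.
move=> Xu Xv; rewrite -sqrtrM ?(ph_ge0 hX)// -sqrtr_sqr.
by rewrite ler_wsqrtr// cauchy_schwarz_sqr.
Qed.

Lemma ph_normD u v : X u -> X v ->
  norm X (fun x => u x + v x) <= norm X u + norm X v.
Proof.
move=> Xu Xv; rewrite -(@ler_pXn2r _ 2)// ?nnegrE ?addr_ge0 ?ph_norm_ge0//.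
have Xuv := ph_add Xu Xv.
rewrite sqrrD !sqr_norm// dotDl// !dotDr// (ph_sym hX Xv Xu).
have := le_trans (ler_norm _) (cauchy_schwarz Xu Xv); lra.
Qed.

Lemma ph_normZ (c : R) u : X u -> norm X (fun x => c * u x) = `|c| * norm X u.
Proof.
move=> Xu; rewrite /norm dotZl// ?dotZr//; last exact: ph_scale.
by rewrite mulrA -expr2 sqrtrM ?sqr_ge0// sqrtr_sqr.
Qed.

Lemma norm_distC u v : X u -> X v -> norm X (u \- v) = norm X (v \- u).
Proof.
move=> Xu Xv; rewrite (_ : u \- v = fun x => -1 * (v \- u) x).
  by rewrite ph_normZ ?normrN1 ?mul1r//; exact: ph_sub.
by apply/funext => x /=; ring.
Qed.

Lemma ph_dist_triangle u v w : X u -> X v -> X w ->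
  norm X (u \- w) <= norm X (u \- v) + norm X (v \- w).
Proof.
move=> Xu Xv Xw; rewrite (_ : u \- w = fun x => (u \- v) x + (v \- w) x).
  by apply: ph_normD; exact: ph_sub.
by apply/funext => x /=; ring.
Qed.

(** Expanding around the limits leaves three inner products, each with a factor tending to 0. The
    filter is arbitrary so that two-sided, one-sided and punctured neighbourhoods in time are all
    covered. *)
Lemma cvg_dot (T : Type) (A : set_system T) {FA : Filter A}
    (p q : T -> R -> R) (p0 q0 : R -> R) :
  X p0 -> X q0 -> (\forall s \near A, X (p s)) -> (\forall s \near A, X (q s)) ->
  norm X (p s \- p0) @[s --> A] --> 0 -> norm X (q s \- q0) @[s --> A] --> 0 ->
  dot X (p s) (q s) @[s --> A] --> dot X p0 q0.
Proof.
move=> Xp0 Xq0 Xp Xq cp cq; apply/subr_cvg0; apply/cvgr0Pnorm_le => e e0.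
have /cvgr0Pnorm_le/(_ _ e0) : norm X (p s \- p0) * norm X (q s \- q0) +
   norm X p0 * norm X (q s \- q0) + norm X (p s \- p0) * norm X q0 @[s --> A] --> 0.
  rewrite [X in _ --> X](_ : 0 = 0 * 0 + norm X p0 * 0 + 0 * norm X q0).
    by apply: cvgD; [apply: cvgD; [exact: cvgM|apply: cvgM => //; exact: cvg_cst]
                    |apply: cvgM => //; exact: cvg_cst].
  by ring.
apply: filterS2 (filterI Xp Xq) => s [Xps Xqs]; apply: le_trans.
apply: le_trans (ler_norm _).
have Xp' := ph_sub Xps Xp0; have Xq' := ph_sub Xqs Xq0.
suff -> : dot X (p s) (q s) - dot X p0 q0 =
  dot X (p s \- p0) (q s \- q0) + dot X p0 (q s \- q0) + dot X (p s \- p0) q0.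
  have := cauchy_schwarz Xp' Xq'; have := cauchy_schwarz Xp0 Xq'.
  have := cauchy_schwarz Xp' Xq0; rewrite !ler_norml; lra.
by rewrite !dotBr// !dotBl//; ring.
Qed.


Lemma has_derivative_dot (f g : R -> R -> R) (t : R) (f' g' : R -> R) : 0 <= t ->
  (forall s, 0 <= s -> X (f s)) -> (forall s, 0 <= s -> X (g s)) ->
  has_derivative X f t f' -> has_derivative X g t g' ->
  (dot X (f s) (g s) - dot X (f t) (g t)) / (s - t)
    @[s --> within [set s : R | 0 <= s /\ s != t] (nbhs t)] -->
  dot X f' (g t) + dot X (f t) g'.
Proof.
move=> t0 Xf Xg [Xf' cf] [Xg' cg].
set A := within _ _ in cf cg *.
have FA : Filter A by exact: within_filter.
have At : \forall s \near A, 0 <= s /\ s != t by exact: withinT.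
pose q (h : R -> R -> R) s : R -> R := fun x => (h s x - h t x) / (s - t).
have Xq h s : (forall r, 0 <= r -> X (h r)) -> 0 <= s -> X (q h s).
  move=> Xh s0; have := ph_scale (s - t)^-1 (ph_sub (Xh s s0) (Xh t t0)).
  by congr (carrier X _); apply/funext => x; rewrite /q mulrC.
(* Writing [h s] through its difference quotient turns the quotient of the product into [(q f, g t)
   + (f t, q g) + (s - t) (q f, q g)], so no separate continuity of [f] and [g] is called for. *)
have qE h s : s != t -> h s = fun x => (s - t) * q h s x + h t x.
  by move=> st; apply/funext => x; rewrite /q; field; rewrite subr_eq0.
have Ast : s - t @[s --> A] --> (0 : R).
  apply: (@cvg_trans _ (s - t @[s --> nbhs t])).
    by apply: cvg_app; exact: cvg_within.
  by rewrite -(subrr t); apply: cvgB; [exact: cvg_id|exact: cvg_cst].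
have nX h : (forall r, 0 <= r -> X (h r)) -> \forall s \near A, X (q h s).
  by move=> Xh; apply: filterS At => s [s0 _]; exact: Xq.
have n0 h : X h -> norm X (h \- h) @[s --> A] --> 0.
  move=> Xh; rewrite (_ : norm X _ = 0); first exact: cvg_cst.
  by rewrite /norm dotBl// ?subrr ?sqrtr0//; exact: ph_sub.
have cX (h : R -> R) : X h -> \forall s \near A, X h by move=> Xh; exact: nearW.
have /(_ FA) c1 := cvg_dot Xf' (Xg t t0) (nX _ Xf) (cX _ (Xg t t0)) cf (n0 _ (Xg t t0)).
have /(_ FA) c2 := cvg_dot (Xf t t0) Xg' (cX _ (Xf t t0)) (nX _ Xg) (n0 _ (Xf t t0)) cg.
have /(_ FA) c3 := cvg_dot Xf' Xg' (nX _ Xf) (nX _ Xg) cf cg.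
have c4 : dot X (q f s) (g t) + dot X (f t) (q g s) +
    (s - t) * dot X (q f s) (q g s) @[s --> A] --> dot X f' (g t) + dot X (f t) g'.
  rewrite -[X in _ --> X]addr0 -[X in _ + X](mul0r (dot X f' g')).
  by apply: cvgD; [exact: cvgD|exact: cvgM].
apply: cvg_trans c4; apply: near_eq_cvg; apply: filterS At => s [s0 st].
have Xqf := Xq f s Xf s0; have Xqg := Xq g s Xg s0.
have Xft := Xf t t0; have Xgt := Xg t t0.
rewrite (qE f s st) (qE g s st).
rewrite dot_lin2//; set a1 := dot X _ _; set a2 := dot X _ _.
by field; rewrite subr_eq0.
Qed.


End PreHilbert.

(** * Square integrable functions *)

Section SquareIntegrable.
Context {R : realType}.
Local Notation leb := (@lebesgue_measure R).
Local Notation measR := (@measurable _ (measurableTypeR R)).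
Local Notation mfunR := (@measurable_fun _ _ (measurableTypeR R) R).
Implicit Types (U : set R) (u v w f g : R -> R).

(* The library's instance is not inferred here: the canonical measurable structure
   of R and [measurableTypeR R] have different displays. The notations [measR] and
   [mfunR] work around the same mismatch. *)
#[global] Instance ae_lebesgue_filter : Filter (nbhs (almost_everywhere leb)).
Proof. exact: (ae_filter_ringOfSetsType leb). Qed.

Definition itg U f := leb.-integrable U (EFin \o f).

Lemma itg_measurable U f : itg U f -> mfunR U f.
Proof. by move=> /measurable_int /measurable_EFinP. Qed.

Lemma le_itg U f g : measR U -> mfunR U f -> itg U g ->
  (forall x, U x -> `|f x| <= g x) -> itg U f.
Proof.
move=> mU mf ig fg; apply: le_integrable ig => //; first exact/measurable_EFinP.
move=> x Ux /=; rewrite lee_fin (le_trans (fg _ Ux))//.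
exact: ler_norm.
Qed.

Lemma itgD U f g : measR U -> itg U f -> itg U g -> itg U (fun x => f x + g x).
Proof. by move=> mU fi gi; exact: (integrableD mU fi gi). Qed.

Lemma itgZ U (c : R) f : measR U -> itg U f -> itg U (fun x => c * f x).
Proof. by move=> mU fi; exact: (integrableZl mU c fi). Qed.

Lemma itgN U f : measR U -> itg U f -> itg U (fun x => - f x).
Proof. 
move=> mU fi; have := itgZ (-1) mU fi.
by congr (itg U _); apply/funext => x; rewrite mulN1r.
Qed.

Lemma itgB U f g : measR U -> itg U f -> itg U g -> itg U (fun x => f x - g x).
Proof. by move=> mU fi gi; apply: itgD => //; exact: itgN. Qed.

Lemma itgS U V f : measR U -> measR V -> V `<=` U -> itg U f -> itg V f.
Proof. by move=> mU mV VU; exact: integrableS. Qed.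

Lemma itg_norm U f : measR U -> itg U f -> itg U (fun x => `|f x|).
Proof. by move=> mU; exact: integrable_norm. Qed.

Lemma L2P U f : measR U ->
  L2 U f <-> mfunR U f /\ itg U (fun x => f x ^+ 2).
Proof.
move=> mU; rewrite /= -[(fun x => _ ^+ 2)]/(fun x => _).
have e : (fun x => ((f \_ U) x ^+ 2)) = (fun x => f x ^+ 2) \_ U.
  by apply/funext => x; rewrite /patch; case: ifP => // _; rewrite expr0n.
split=> [f2|[mf fi]].
  split.
    apply/(measurable_restrictT _ mU).
    by move: f2; rewrite inE => /andP[]; rewrite inE.
  have := Lfun2_integrable_sqr f2; rewrite /itg e.
  by rewrite -restrict_EFin => /(integrable_mkcond _ mU).
have mf' : mfunR setT (f \_ U) by apply/(measurable_restrictT _ mU).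
rewrite inE; apply/andP; split; rewrite inE//=.
rewrite /finite_norm unlock /=.
apply: poweR_lty.
have : leb.-integrable setT (EFin \o ((fun x => f x ^+ 2) \_ U)).
  by rewrite -restrict_EFin; apply/(integrable_mkcond _ mU).
move=> /integrableP[_]; apply: le_lt_trans; apply: ge0_le_integral => //=.
- apply/measurable_EFinP.
  apply/(@measurableT_comp _ _ _ _ _ _ (fun x : R => x `^ 2)%R) => //.
  exact/measurableT_comp.
- apply/measurable_EFinP; rewrite -e; apply: measurableT_comp => //.
  exact: measurable_funX.
- by move=> x _; rewrite lee_fin -e normrX powR_mulrn.
Qed.

Lemma L2_measurable U f : measR U -> L2 U f -> mfunR U f.
Proof. by move=> mU /(L2P _ mU)[]. Qed.

Lemma L2_sqr U f : measR U -> L2 U f -> itg U (fun x => f x ^+ 2).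
Proof. by move=> mU /(L2P _ mU)[]. Qed.

Lemma L2_itgM U f g : measR U -> L2 U f -> L2 U g -> itg U (fun x => f x * g x).
Proof.
move=> mU /(L2P _ mU)[mf f2] /(L2P _ mU)[mg g2].
apply: (le_itg mU _ (itgD mU f2 g2)); first exact: measurable_funM.
move=> x _; rewrite normrM -(real_normK (num_real (f x))).
by rewrite -(real_normK (num_real (g x))); nra.
Qed.

Lemma L2_lin U (c : R) f g : measR U -> L2 U f -> L2 U g ->
  L2 U (fun x => c * f x + g x).
Proof.
move=> mU fL gL; apply/L2P => //; split.
  by apply: measurable_funD; [apply: measurable_funM => //|]; exact: L2_measurable.
have := itgD mU (itgD mU (itgZ (c ^+ 2) mU (L2_sqr mU fL))
  (itgZ (2 * c) mU (L2_itgM mU fL gL))) (L2_sqr mU gL).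
by congr (itg U _); apply/funext => x; ring.
Qed.

Lemma L2_pre_hilbert U : measR U -> pre_hilbert (L2 U).
Proof.
move=> mU; split.
- by move=> *; exact: L2_lin.
- by move=> u v _ _; apply: eq_Rintegral => x _; rewrite mulrC.
- move=> c u v w uL vL wL /=; rewrite -RintegralZl//; last exact: L2_itgM.
  rewrite -RintegralD//; [|exact/itgZ/L2_itgM|exact: L2_itgM].
  by apply: eq_Rintegral => x _; ring.
- by move=> u _; apply: Rintegral_ge0 => x _; rewrite -expr2 sqr_ge0.
Qed.

Lemma ae_eq_on_refl U f : ae_eq_on U f f.
Proof. exact: ae_eq_refl. Qed.

Lemma ae_eq_on_sym U f g : ae_eq_on U f g -> ae_eq_on U g f.
Proof. exact: ae_eq_sym. Qed.

Lemma ae_eq_on_trans U f g h : ae_eq_on U f g -> ae_eq_on U g h -> ae_eq_on U f h.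
Proof. exact: ae_eq_trans. Qed.

Lemma eq_Rintegral_ae U f g : measR U ->
  mfunR U f -> mfunR U g -> ae_eq_on U f g ->
  \int[leb]_(x in U) f x = \int[leb]_(x in U) g x.
Proof.
move=> mU mf mg fg; rewrite /Rintegral; congr fine; apply: ae_eq_integral => //.
- exact/measurable_EFinP.
- exact/measurable_EFinP.
- by apply: filterS fg => x /= h Ux; rewrite h.
Qed.

Lemma ae_eq_dot U f g h k : measR U -> L2 U f -> L2 U g -> L2 U h -> L2 U k ->
  ae_eq_on U f g -> ae_eq_on U h k -> dot (L2 U) f h = dot (L2 U) g k.
Proof.
move=> mU fL gL hL kL fg hk; apply: eq_Rintegral_ae => //.
- by apply: measurable_funM; exact: L2_measurable.
- by apply: measurable_funM; exact: L2_measurable.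
- by apply: filterS2 fg hk => x /= h1 h2 Ux; rewrite h1// h2.
Qed.

(** The difference [g - f] agrees almost everywhere with its absolute value, whose integral is
    nonnegative. *)
Lemma le_Rintegral_ae U f g : measR U -> itg U f -> itg U g ->
  {ae leb, forall x, U x -> f x <= g x} ->
  \int[leb]_(x in U) f x <= \int[leb]_(x in U) g x.
Proof.
move=> mU fi gi fg; rewrite -subr_ge0 -RintegralB//.
have mfg : mfunR U (fun x => g x - f x).
  by apply: itg_measurable; exact: itgB.
rewrite (@eq_Rintegral_ae _ _ (fun x => `|g x - f x|))//.
- exact: Rintegral_ge0.
- exact: measurableT_comp.
- by apply: filterS fg => x /= h Ux; rewrite ger0_norm// subr_ge0 h.
Qed.

Lemma L2_norm0_ae U f : measR U -> L2 U f -> norm (L2 U) f = 0 ->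
  ae_eq_on U f (cst 0).
Proof.
move=> mU fL /eqP; rewrite sqrtr_eq0 => f0.
have fi := L2_sqr mU fL.
have : (\int[leb]_(x in U) `|(f x ^+ 2)%:E| = 0)%E.
  rewrite (_ : (\int[leb]_(x in U) _ = \int[leb]_(x in U) (f x * f x)%:E)%E); last first.
    by apply: eq_integral => x _ /=; rewrite ger0_norm ?sqr_ge0// expr2.
  have fi' : itg U (fun x => f x * f x) by exact: L2_itgM.
  rewrite -[LHS]fineK; last exact: integrable_fin_num.
  congr EFin; apply/eqP; rewrite eq_le f0 /=.
  by apply: Rintegral_ge0 => x _; rewrite -expr2 sqr_ge0.
move=> /ae_eq_integral_abs => /(_ mU (measurable_int leb fi)).
apply: filterS => x /= h Ux; have := h Ux.
by move=> [] /eqP; rewrite sqrf_eq0 => /eqP.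
Qed.

Lemma ae_eq_L2 U f g : measR U -> L2 U f -> mfunR U g ->
  ae_eq_on U f g -> L2 U g.
Proof.
move=> mU fL mg fg; apply/L2P => //; split => //.
have mf := L2_measurable mU fL; apply/integrableP; split.
  by apply/measurable_EFinP; exact: measurable_funX.
have /integrableP[_] := L2_sqr mU fL; apply: le_lt_trans.
rewrite le_eqVlt; apply/orP; left; apply/eqP.
apply: ge0_ae_eq_integral => //.
- by apply/measurable_EFinP/measurableT_comp => //; exact: measurable_funX.
- by apply/measurable_EFinP/measurableT_comp => //; exact: measurable_funX.
- by apply: filterS fg => x /= h Ux; rewrite h.
Qed.

Lemma dist_eq_ae_L2 U f g : measR U -> L2 U f -> L2 U g ->
  norm (L2 U) (f \- g) = 0 -> ae_eq_on U f g.
Proof.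
move=> mU fL gL /(L2_norm0_ae mU (ph_sub (L2_pre_hilbert mU) fL gL)).
by apply: filterS => x /= h Ux; apply/eqP; rewrite -subr_eq0 h.
Qed.

Lemma L2_normr U f : measR U -> L2 U f -> L2 U (fun x => `|f x|).
Proof.
move=> mU fL; apply/L2P => //; split.
  by apply: measurableT_comp => //; exact: L2_measurable.
have := L2_sqr mU fL; congr (itg U _); apply/funext => x.
by rewrite real_normK// num_real.
Qed.

Lemma norm_normr U f : norm (L2 U) (fun x => `|f x|) = norm (L2 U) f.
Proof.
rewrite /norm; congr Num.sqrt; apply: eq_Rintegral => x _.
by rewrite -!expr2 real_normK// num_real.
Qed.

Lemma ge0_subset_Rintegral U V f : measR U -> measR V -> V `<=` U -> itg U f ->
  (forall x, U x -> 0 <= f x) ->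
  \int[leb]_(x in V) f x <= \int[leb]_(x in U) f x.
Proof.
move=> mU mV VU fi f0; apply: fine_le; [|exact: integrable_fin_num|].
  by apply: integrable_fin_num => //; exact: itgS fi.
apply: ge0_subset_integral => //.
  exact: (measurable_int leb fi).
Qed.

End SquareIntegrable.

(** * Smooth functions and test functions *)

Section Smooth.
Context {R : realType}.
Implicit Types (f g phi psi : R -> R).

Definition smooth f : Prop := forall n (x : R), derivable (derive1n n f) x 1.

(** A coinduction principle: closure of a family under differentiation replaces any formula for the
    n-th derivative. *)
Lemma smooth_coind (S : set (R -> R)) :
  (forall f, S f -> exists2 g, S g & forall x : R, is_derive x (1 : R) f (g x)) ->
  S `<=` smooth.
Proof.
move=> hS f Sf n; elim: n f Sf => [|n IH] f Sf x.
  by have [g _ fg] := hS f Sf; exact: (@ex_derive _ _ _ _ _ _ _ (fg x)).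
have [g Sg fg] := hS f Sf; rewrite /derive1n iterSr.
rewrite (_ : derive1 f = g); first exact: IH.
by apply/funext => y; rewrite derive1E (@derive_val _ _ _ _ _ _ _ (fg y)).
Qed.

Lemma smooth_derive1 f : smooth f -> smooth (derive1 f).
Proof. by move=> sf n x; have := sf n.+1 x; rewrite /derive1n iterSr. Qed.

Lemma smooth_derivable f x : smooth f -> derivable f x 1.
Proof. by move=> /(_ 0%N x). Qed.

Lemma smooth_continuous f : smooth f -> continuous f.
Proof.
by move=> sf x; apply: differentiable_continuous; apply/derivable1_diffP/smooth_derivable.
Qed.

Lemma is_derive_lin (c : R) f g (x a b : R) :
  is_derive x (1 : R) f a -> is_derive x (1 : R) g b ->
  is_derive x (1 : R) (fun x => c * f x + g x) (c * a + b).
Proof. by move=> fa gb; exact: (is_deriveD (is_deriveZ c fa) gb). Qed.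

Lemma derive1n_lin (c : R) f g n : smooth f -> smooth g ->
  derive1n n (fun x => c * f x + g x) =
  (fun x => c * derive1n n f x + derive1n n g x).
Proof.
move=> sf sg; elim: n => // n IH; rewrite derive1nS IH; apply/funext => x.
rewrite !derive1nS !derive1E; apply: derive_val.
have h1 := DeriveDef (sf n x) erefl; have h2 := DeriveDef (sg n x) erefl.
exact: is_derive_lin.
Qed.

Lemma smooth_lin (c : R) f g : smooth f -> smooth g ->
  smooth (fun x => c * f x + g x).
Proof.
move=> sf sg n x; rewrite derive1n_lin//.
have h1 := DeriveDef (sf n x) erefl; have h2 := DeriveDef (sg n x) erefl.
by have /(_ c) [] := is_derive_lin _ h1 h2.
Qed.

(* The functions [x |-> x^-k exp(-1/x)] extended by 0 vanish to infinite order
   at 0, and their span is closed under differentiation. *)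
Definition flat (k : nat) (x : R) : R :=
  if 0 < x then x ^- k * expR (- x^-1) else 0.

(** With [y = 1/x], the quantity is [x * y^(k+1) / exp y], and [exp y] dominates [y^(k+1) / (k+1)!].
    The factor [x] gives continuity at 0. *)
Lemma flat_le k x : `|flat k x| <= k.+1`!%:R * `|x|.
Proof.
rewrite /flat; case: ltP => x0; last by rewrite normr0 mulr_ge0.
rewrite !gtr0_norm//; last by rewrite mulr_gt0 ?expR_gt0// invr_gt0 exprn_gt0.
have y0 : 0 < x^-1 by rewrite invr_gt0.
have := expR_ge1Dxn k (ltW y0); rewrite expRN -exprVn.
have e0 : 0 < expR x^-1 := expR_gt0 _.
have f0 : 0 < k.+1`!%:R :> R by rewrite ltr0n fact_gt0.
move=> h; rewrite ler_pdivrMr//.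
have -> : x^-1 ^+ k = x * x^-1 ^+ k.+1 by rewrite exprS mulrA divff ?mul1r// gt_eqF.
rewrite -mulrA [leRHS]mulrCA ler_pM2l// mulrC -ler_pdivrMr//; lra.
Qed.

Lemma flat_ge0 k x : 0 <= flat k x.
Proof.
rewrite /flat; case: ltP => // x0.
by rewrite mulr_ge0 ?expR_ge0// invr_ge0 exprn_ge0// ltW.
Qed.

Lemma is_derive_flat k x :
  is_derive x (1 : R) (flat k) (flat k.+2 x - k%:R * flat k.+1 x).
Proof.
have [x0|x0|->] := ltgtP x 0.
- rewrite /flat ltNge ltW//= mulr0 subr0.
  apply: (@near_eq_is_derive _ _ _ (cst 0)).
  by near=> y; rewrite ltNge ltW//=; near: y; exact: lt_nbhsl.
- apply: (@near_eq_is_derive _ _ _ (fun y : R => (y ^- k) * expR (- y^-1))).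
    by near=> y; rewrite /flat ifT//; near: y; exact: lt_nbhsr.
  have xn0 : x != 0 by rewrite gt_eqF.
  have hV : is_derive x (1 : R) (fun y => y^-1) (- x ^- 2).
    by have := @is_deriveV _ id x 1 1 xn0 (is_derive_id _ _); rewrite /GRing.scale/= mulr1.
  have hE : is_derive x (1 : R) (fun y => expR (- y^-1)) (expR (- x^-1) * - (- x ^- 2)).
    exact: (@is_derive1_comp _ expR (fun y => - y^-1)).
  have hP : is_derive x (1 : R) (fun y => y ^- k) (- (x ^+ k) ^- 2 * (k%:R * x ^+ k.-1)).
    apply: (@is_deriveV _ (fun y => y ^+ k) x (k%:R * x ^+ k.-1) 1).
      by rewrite expf_eq0 (negPf xn0) andbF.
    have := @is_deriveX _ _ (@id R) k x 1 1 (is_derive_id _ _).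
    by rewrite exprfctE /GRing.scale/= mulr1.
  apply: is_derive_eq; rewrite /flat x0 /GRing.scale/=.
  move: (expR _) => E; clear -xn0.
  case: k => [|j]; first by rewrite /= expr1 expr0; field.
  rewrite [j.+1.-1]/= !exprS; have : x ^+ j != 0 by rewrite expf_neq0.
  by move: (x ^+ j) => p p0; field; rewrite p0.
- have flat0 j : flat j 0 = 0 by rewrite /flat ltxx.
  rewrite !flat0 mulr0 subr0; apply/is_derive1_caratheodory.
  (* The slope of [flat k] from 0 is [flat k x / x = flat k.+1 x], continuous at 0 by [flat_le]. *)
  exists (flat k.+1); split => //.
  + move=> z; rewrite flat0 !subr0 /flat; case: ltP => z0; last by rewrite mul0r.
    have p0 : z ^+ k != 0 by rewrite expf_neq0// gt_eqF.
    rewrite exprS; move: (z ^+ k) p0 => p p0. field.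
    by rewrite p0 gt_eqF.
  + rewrite /prop_for/= /continuous_at flat0; apply/cvgr0Pnorm_le => e e0.
    have e1 : 0 < e / k.+2`!%:R by rewrite divr_gt0// ltr0n fact_gt0.
    near=> z; apply: le_trans (flat_le _ _) _.
    rewrite mulrC -ler_pdivlMr ?ltr0n ?fact_gt0//.
Unshelve. all: by end_near. Qed.

End Smooth.

(** * Test functions, cutoffs and the fundamental lemma of the calculus of variations *)

Section TestFunctions.
Context {R : realType}.
Local Notation leb := (@lebesgue_measure R).
Local Notation measR := (@measurable _ (measurableTypeR R)).
Local Notation mfunR := (@measurable_fun _ _ (measurableTypeR R) R).
Implicit Types (U : set R) (f g phi psi w : R -> R).

(** An algebra generated by affine substitutions in [flat]: large enough to contain the cutoffs
    below, and stable under differentiation, so that [smooth_coind] applies. *)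
Inductive flat_gen : (R -> R) -> Prop :=
| FlatAff k (c d : R) : flat_gen (fun x => flat k (c * x + d))
| FlatLin (c : R) f g : flat_gen f -> flat_gen g -> flat_gen (fun x => c * f x + g x)
| FlatMul f g : flat_gen f -> flat_gen g -> flat_gen (fun x => f x * g x).

Lemma flat_gen_smooth : flat_gen `<=` @smooth R.
Proof.
apply: smooth_coind => f; elim=> [k c d|c {}f g _ [f' Sf' ff'] _ [g' Sg' gg']|
  {}f g Sf [f' Sf' ff'] Sg [g' Sg' gg']].
(* The coefficient of [flat k.+1] is [- c * k]; it is split as [(- c * k - 1) + 1] because [FlatLin]
   always has a last summand with coefficient 1. *)
- exists (fun x => c * flat k.+2 (c * x + d) +
    ((- c * k%:R - 1) * flat k.+1 (c * x + d) + flat k.+1 (c * x + d))).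
    by apply: FlatLin; [|apply: FlatLin]; exact: FlatAff.
  move=> x; have ha : is_derive x (1 : R) (fun x => c * x + d) c.
    have := is_derive_lin c (is_derive_id x 1) (is_derive_cst d x 1).
    by rewrite mulr1 addr0.
  have := @is_derive1_comp _ (flat k) _ x _ _ (is_derive_flat k (c * x + d)) ha.
  by move=> h; apply: (is_derive_eq h); ring.
- exists (fun x => c * f' x + g' x); first exact: FlatLin.
  by move=> x; exact: is_derive_lin.
- exists (fun x => 1 * (f x * g' x) + g x * f' x).
    by apply: FlatLin; exact: FlatMul.
  by move=> x; have := is_deriveM (ff' x) (gg' x); rewrite mul1r.
Qed.

(** Any compact subset of [U] carrying [phi] may stand for the support, so sums and derivatives need
    no computation of closures. *)
Lemma test_functionP U phi : test_function U phi <->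
  smooth phi /\ exists K, [/\ compact K, K `<=` U & forall x, ~ K x -> phi x = 0].
Proof.
split=> [[sphi cK KU]|[sphi [K [cK KU K0]]]].
  split => //; exists (closure [set x | phi x != 0]); split => // x Kx.
  by apply/eqP/negPn/negP => phix; apply/Kx/subset_closure.
have KK : closure [set x | phi x != 0] `<=` K.
  have /closure_id -> : closed K by apply: compact_closed => //; exact: Rhausdorff.
  apply: closure_subset => x /= /eqP phix; apply: contrapT => Kx; apply: phix.
  exact: K0.
split => //; last exact: subset_trans KU.
by apply: subclosed_compact cK KK; exact: closed_closure.
Qed.

Lemma test_smooth U phi : test_function U phi -> smooth phi.
Proof. by case/test_functionP. Qed.

Lemma test_subset U V phi : U `<=` V -> test_function U phi -> test_function V phi.
Proof. by move=> UV [h1 h2 h3]; split => //; exact: subset_trans UV. Qed.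

Lemma test_out U phi x : test_function U phi -> ~ U x -> phi x = 0.
Proof. by case/test_functionP => _ [K [_ KU K0]] Ux; apply: K0 => /KU. Qed.

Lemma test_lin U (c : R) phi psi : test_function U phi -> test_function U psi ->
  test_function U (fun x => c * phi x + psi x).
Proof.
move=> /test_functionP[sf [K [cK KU K0]]] /test_functionP[sg [L [cL LU L0]]].
apply/test_functionP; split; first exact: smooth_lin.
exists (K `|` L); split; first exact: compactU.
  by rewrite subUset.
by move=> x /not_orP[Kx Lx]; rewrite K0// L0// mulr0 addr0.
Qed.

Lemma test_derive1 U phi : test_function U phi -> test_function U (derive1 phi).
Proof.
move=> /test_functionP[sf [K [cK KU K0]]].
apply/test_functionP; split; first exact: smooth_derive1.
exists K; split => // x Kx.
have oK : open (~` K) by apply: closed_openC; apply: compact_closed cK; exact: Rhausdorff.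
rewrite derive1E; apply: derive_val.
apply: (@near_eq_is_derive _ _ _ (cst 0)).
have : nbhs x (~` K) by exact: open_nbhs_nbhs.
by apply: filterS => y /K0 ->.
Qed.

Lemma test_derive1n U n phi : test_function U phi -> test_function U (derive1n n phi).
Proof. by elim: n => // n IH /IH; rewrite derive1nS; exact: test_derive1. Qed.

Lemma test_measurable U phi V : measR V -> test_function U phi -> mfunR V phi.
Proof.
move=> mV /test_smooth/smooth_continuous cphi.
by apply: (@measurable_funTS _ _ (measurableTypeR R)) => //; exact: continuous_measurable_fun.
Qed.

Lemma test_bounded U phi : test_function U phi -> exists M : R, forall x, `|phi x| <= M.
Proof.
move=> /[dup] /test_smooth/smooth_continuous cphi /test_functionP[_ [K [cK _ K0]]].
have /compact_bounded[M [_ HM]] : compact (phi @` K).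
  by apply: continuous_compact => //; exact: continuous_subspaceT.
exists (`|M| + 1) => x; have [Kx|/K0 ->] := pselect (K x); last by rewrite normr0 addr_ge0.
by apply: (HM (`|M| + 1)); [rewrite (le_lt_trans (ler_norm M)) ?ltrDl|exists x].
Qed.

Lemma test_itgM U V phi w : measR V -> test_function U phi -> itg V w ->
  itg V (fun x => w x * phi x).
Proof.
move=> mV tphi wi; have [M phiM] := test_bounded tphi.
apply: (le_itg mV _ (itgZ M mV (itg_norm mV wi))).
  by apply: measurable_funM; [exact: itg_measurable|exact: test_measurable tphi].
by move=> x _; rewrite normrM mulrC ler_wpM2r.
Qed.

Lemma finite_itg_cst (a b c : R) : itg `]a, b[ (fun=> c).
Proof.
apply: measurable_bounded_integrable => //; last first.
  by exists `|c|; split => // M cM x _; exact: ltW.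
by rewrite /= lebesgue_measure_itv/=; case: ifP => // _; rewrite -EFinB ltry.
Qed.

Lemma test_L2 U phi (a b : R) : test_function U phi -> L2 `]a, b[ phi.
Proof.
move=> tphi; apply/L2P => //; split; first exact: test_measurable tphi.
have [M phiM] := test_bounded tphi.
apply: (le_itg _ _ (finite_itg_cst a b (M ^+ 2))) => //.
  by apply: measurable_funX; exact: test_measurable tphi.
by move=> x _; rewrite normrX ler_sqr ?nnegrE// (le_trans _ (phiM x)).
Qed.

(** A smooth approximation of the indicator of []a, b[]. The first factor vanishes up to
    [a + 1/(n+1)], which keeps the support away from [a]; the second vanishes only from [b] on, so
    the support may reach [b] and is compact in []a, c[] for [c > b]. Inside, both arguments tend to
    infinity, where [flat 0] tends to 1. *)
Definition bump (a b : R) (n : nat) (x : R) : R :=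
  flat 0 (n.+1%:R * (x - a) - 1) * flat 0 (n.+1%:R * (b - x)).

Lemma bump_test (a b c : R) n : b < c -> test_function `]a, c[ (bump a b n).
Proof.
move=> bc; apply/test_functionP; split.
  apply: flat_gen_smooth; apply: FlatMul.
    have := FlatAff 0 n.+1%:R (- n.+1%:R * a - 1); congr flat_gen.
    by apply/funext => x; congr flat; ring.
  have := FlatAff 0 (- n.+1%:R) (n.+1%:R * b); congr flat_gen.
  by apply/funext => x; congr flat; ring.
have n0 : 0 < n.+1%:R :> R by [].
exists [set` `[a + n.+1%:R^-1, b]]; split; first exact: segment_compact.
  move=> x /=; rewrite !in_itv/= => /andP[ax xb]; rewrite (le_lt_trans xb)// andbT.
  by rewrite (lt_le_trans _ ax)// ltrDl invr_gt0.
move=> x /=; rewrite in_itv/= => /negP; rewrite negb_and -!ltNge => /orP[xa|bx].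
  rewrite /bump {1}/flat ifF ?mul0r//; apply/negbTE; rewrite -leNgt subr_le0.
  by rewrite mulrC -ler_pdivlMr// div1r lerBlDl ltW.
rewrite /bump {2}/flat ifF ?mulr0//; apply/negbTE; rewrite -leNgt.
by rewrite pmulr_rle0// subr_le0 ltW.
Qed.

Lemma flat0_le1 x : flat 0 x <= 1 :> R.
Proof.
rewrite /flat; case: ltP => // x0.
by rewrite expr0 invr1 mul1r expR_le1 oppr_le0 invr_ge0 ltW.
Qed.

Lemma bump_le1 (a b : R) n x : `|bump a b n x| <= 1.
Proof.
rewrite /bump ger0_norm ?mulr_ge0 ?flat_ge0//.
by rewrite mulr_ile1 ?flat_ge0 ?flat0_le1.
Qed.

Lemma cvg_flat0 (u : R^nat) : u @ \oo --> +oo -> flat 0 (u n) @[n --> \oo] --> (1 : R).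
Proof.
move=> uy.
have h : expR (- (u n)^-1) @[n --> \oo] --> (1 : R).
  rewrite -expR0 -oppr0; apply: continuous_cvg; first exact: continuous_expR.
  apply: cvgN; apply/gtr0_cvgV0 => //.
  have /cvgryPgt := uy; exact.
apply: cvg_trans h; apply: near_eq_cvg.
have /cvgryPgt/(_ 0) := uy; apply: filterS => n un.
by rewrite /flat un expr0 invr1 mul1r.
Qed.

Lemma bump_cvg (a b x : R) : a < x ->
  bump a b n x @[n --> \oo] --> (if x < b then 1 else 0 : R).
Proof.
move=> ax; have cy (M A : R) : 0 < M -> \forall n \near \oo, A < n.+1%:R * M.
  move=> M0; have : n.+1%:R @[n --> \oo] --> (+oo : set_system R).
    by rewrite cvg_shiftS; exact: cvgr_idn.
  by move=> /cvgryPgt/(_ (A / M)); apply: filterS => n; rewrite ltr_pdivrMr.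
case: ltP => xb; last first.
  rewrite (_ : (fun n => _) = fun=> 0 : R); first exact: cvg_cst.
  apply/funext => n; rewrite /bump {2}/flat ifF ?mulr0//; apply/negbTE; rewrite -leNgt.
  by rewrite pmulr_rle0// subr_le0.
rewrite -(mulr1 1); apply: cvgM; apply: cvg_flat0.
  apply/cvgryPgt => A; have := cy (x - a) (A + 1).
  by rewrite subr_gt0 => /(_ ax); apply: filterS => n; rewrite ltrBrDr.
by apply/cvgryPgt => A; apply: cy; rewrite subr_gt0.
Qed.

(** Dominated convergence along [bump a d n], with dominating function [|w|], shows that the
    primitive of [w] vanishes. The almost everywhere and the pointwise versions below follow by
    differentiating this primitive. *)
Lemma integral_test_eq0 (a b : R) w : itg `]a, b[ w ->
  (forall phi, test_function `]a, b[ phi ->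
    \int[leb]_(x in `]a, b[) (w x * phi x) = 0) ->
  forall d, d < b -> \int[leb]_(x in `]a, d]) w x = 0.
Proof.
move=> wi w0 d db.
have wbi n : itg `]a, b[ (fun x => w x * bump a d n x).
  by apply: (test_itgM _ (bump_test a n db) wi).
pose wd := (fun x => w x * (if x < d then 1 else 0)).
have mwd : mfunR `]a, b[ wd.
  apply: measurable_funM; first exact: itg_measurable.
  apply: (@measurable_funTS _ _ (measurableTypeR R)).
  by apply: measurable_fun_ifT => //; exact: measurable_fun_ltr.
have mf n : measurable_fun (`]a, b[%classic : set (measurableTypeR R))
    (fun x => (w x * bump a d n x)%:E).
  by apply/measurable_EFinP; exact: itg_measurable (wbi n).
have mf' : measurable_fun (`]a, b[%classic : set (measurableTypeR R)) (EFin \o wd).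
  exact/measurable_EFinP.
have cf : {ae leb, forall x, `]a, b[%classic x ->
    (w x * bump a d n x)%:E @[n --> \oo] --> (EFin \o wd) x}.
  apply: aeW => x /=; rewrite in_itv/= => /andP[ax _].
  apply: cvg_EFin; first exact: nearW.
  by apply: cvgM; [exact: cvg_cst|exact: bump_cvg].
have dom : {ae leb, forall x n, `]a, b[%classic x ->
    (`|(w x * bump a d n x)%:E| <= `|w x|%:E)%E}.
  apply: aeW => x n _; rewrite lee_fin normrM -[leRHS]mulr1.
  by rewrite ler_wpM2l// bump_le1.
have mI : measR `]a, b[ by exact: measurable_itv.
have [_ _] := @dominated_convergence _ (measurableTypeR R) R leb _ mI _ _ _ mf mf' cf
  (itg_norm mI wi) dom.
have -> : [sequence (\int[leb]_(x in `]a, b[) (w x * bump a d n x)%:E)%E]_n =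
    fun=> 0%:E.
  apply/funext => n /=; rewrite -[LHS]fineK; last exact: integrable_fin_num (wbi n).
  by congr EFin; apply: w0; exact: bump_test.
move=> /(cvg_unique _ (cvg_cst 0%:E)) wd0.
rewrite -Rintegral_itv_bndo_bndc; last first.
  apply: (@itgS _ `]a, b[) => //; apply: subset_itvl.
  by rewrite bnd_simp ltW.
have {}wd0 := wd0 (@ereal_hausdorff R).
transitivity (\int[leb]_(x in `]a, b[) wd x); last by rewrite /Rintegral -wd0.
rewrite Rintegral_mkcond [RHS]Rintegral_mkcond; apply: eq_Rintegral => x _.
rewrite /patch /wd !mem_setE !in_itv/=.
have [xd|xd] := ltP x d; last by rewrite andbF mulr0; case: ifP.
by rewrite (lt_trans xd db) mulr1.
Qed.

Lemma test_eq0_ae (a b : R) w : itg `]a, b[ w ->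
  (forall phi, test_function `]a, b[ phi ->
    \int[leb]_(x in `]a, b[) (w x * phi x) = 0) ->
  ae_eq_on `]a, b[ w (cst 0).
Proof.
move=> wi w0; have W0 := integral_test_eq0 wi w0.
have mI : measR `]a, b[ by exact: measurable_itv.
(* Extension by 0 makes the function integrable on the whole line, as Lebesgue differentiation
   requires here. *)
pose f := w \_ `]a, b[.
have fi V : measR V -> itg V f.
  move=> mV; apply: (@itgS _ setT) => //.
  rewrite /itg /f -restrict_EFin.
  by apply/(integrable_mkcond _ mI).
have fl : locally_integrable [set: R] f by apply: integrable_locally.
have := @FTC1 R f (BRight a) (fun y => fi _ (measurable_itv _)) fl.
apply: filterS => x /= hx xU; move: (xU); rewrite in_itv/= => /andP[ax xb].
have [_] := hx ax; rewrite /f patchE mem_set// => <-.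
rewrite derive1E; apply: derive_val; apply: (@near_eq_is_derive _ _ _ (cst 0)).
near=> y; have yb : y < b by near: y; exact: lt_nbhsl.
rewrite -[LHS](W0 y yb); apply: eq_Rintegral => z; rewrite inE/= in_itv/= => /andP[az zy].
by rewrite patchE mem_set//= in_itv/= az (le_lt_trans zy yb).
Unshelve. all: by end_near. Qed.

(** At a point of continuity the primitive is differentiable with derivative [w x], so nothing is
    lost to a null set; this serves the equation in time. *)
Lemma test_eq0_pt (a b : R) w x : itg `]a, b[ w ->
  (forall phi, test_function `]a, b[ phi ->
    \int[leb]_(x in `]a, b[) (w x * phi x) = 0) ->
  x \in `]a, b[ -> {for x, continuous w} -> w x = 0.
Proof.
move=> wi w0; rewrite in_itv/= => /andP[ax xb] wx.
have W0 := integral_test_eq0 wi w0.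
have xm : x < (x + b) / 2 by rewrite midf_lt.
have mi : itg [set` Interval (BRight a) (BRight ((x + b) / 2))] w.
  apply: (@itgS _ `]a, b[) => //; apply: subset_itvl.
  by rewrite bnd_simp midf_lt.
have [] := @continuous_FTC1 R w (BRight a) x _ xm mi; [exact: ax|exact: wx|].
move=> _ <-.
rewrite derive1E; apply: derive_val; apply: (@near_eq_is_derive _ _ _ (cst 0)).
near=> y; have yb : y < b by near: y; exact: lt_nbhsl.
by rewrite W0.
Unshelve. all: by end_near. Qed.

End TestFunctions.

(** * Weak derivatives on a bounded interval *)

Section WeakDerivatives.
Context {R : realType}.
Local Notation leb := (@lebesgue_measure R).
Local Notation measR := (@measurable _ (measurableTypeR R)).
Variables (a b : R) (ab : a < b).
Local Notation U := (`]a, b[%classic : set R).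
Implicit Types (f g phi psi u v w : R -> R).

Let mU : measR U. Proof. exact: measurable_itv. Qed.
Let phL2 : pre_hilbert (L2 U). Proof. exact: L2_pre_hilbert. Qed.

Lemma L2_cst (c : R) : L2 U (fun=> c).
Proof. by apply/L2P => //; split => //; exact: finite_itg_cst. Qed.

Lemma L2_itg f : L2 U f -> itg U f.
Proof.
move=> fL; have := L2_itgM mU fL (L2_cst 1).
by congr (itg U _); apply/funext => x; rewrite mulr1.
Qed.

Lemma ae_eq_norm f g : L2 U f -> L2 U g -> ae_eq_on U f g ->
  norm (L2 U) f = norm (L2 U) g.
Proof. by move=> fL gL fg; rewrite /norm (ae_eq_dot mU fL gL fL gL fg fg). Qed.

Lemma wderiv_ae_unique k u v w z : L2 U u -> L2 U v -> L2 U w -> L2 U z ->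
  weak_derivative U k u w -> weak_derivative U k v z ->
  ae_eq_on U u v -> ae_eq_on U w z.
Proof.
move=> uL vL wL zL uw vz uv; have wzi : itg U (w \- z) by apply: L2_itg; exact: ph_sub.
have /(test_eq0_ae wzi) : forall phi, test_function U phi ->
    \int[leb]_(x in U) ((w \- z) x * phi x) = 0.
  move=> phi tphi; have pL : L2 U phi by exact: test_L2 tphi.
  have pkL : L2 U (derive1n k phi) by apply: test_L2; exact: test_derive1n tphi.
  have := dotBl phL2 wL zL pL => /= ->; apply/eqP; rewrite subr_eq0; apply/eqP.
  apply: (@mulfI _ ((-1) ^+ k)); first by rewrite signr_eq0.
  rewrite -uw// -vz//; exact: (ae_eq_dot mU uL vL pkL pkL uv (ae_eq_on_refl _ _)).
by apply: filterS => x /= h Ux; apply/eqP; rewrite -subr_eq0 h.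
Qed.

Lemma weak_derivative_lin k (c : R) u v w z : L2 U u -> L2 U v -> L2 U w -> L2 U z ->
  weak_derivative U k u w -> weak_derivative U k v z ->
  weak_derivative U k (fun x => c * u x + v x) (fun x => c * w x + z x).
Proof.
move=> uL vL wL zL uw vz phi tphi.
have pL : L2 U phi by exact: test_L2 tphi.
have pkL : L2 U (derive1n k phi) by apply: test_L2; exact: test_derive1n tphi.
have := ph_dotl phL2 c uL vL pkL; have := ph_dotl phL2 c wL zL pL => /= -> ->.
by rewrite uw// vz//; ring.
Qed.

Lemma weak_derivative0 u : weak_derivative U 0 u u.
Proof. by move=> phi _; rewrite expr0 mul1r. Qed.

Lemma weak_derivativeD j k u v w :
  weak_derivative U j u v -> weak_derivative U k v w -> weak_derivative U (j + k) u w.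
Proof.
move=> uv vw phi tphi; have := uv _ (test_derive1n k tphi).
rewrite /derive1n -iterD -/(derive1n _ _) => ->.
by rewrite vw// exprD mulrA.
Qed.

(** Testing against [derive1n k phi] compares the two orders. This links the derivatives of
    different orders of one function, which [wderiv] selects independently of each other. *)
Lemma weak_derivative_sub j k u v w :
  weak_derivative U j u v -> weak_derivative U (j + k) u w -> weak_derivative U k v w.
Proof.
move=> uv uw phi tphi; have := uv _ (test_derive1n k tphi).
rewrite /derive1n -iterD -/(derive1n _ _) uw// exprD -mulrA.
by move=> /mulfI -> //; rewrite signr_eq0.
Qed.

Lemma test_by_parts phi psi : test_function U phi -> test_function U psi ->
  \int[leb]_(x in U) (phi x * derive1 psi x) =
  - \int[leb]_(x in U) (derive1 phi x * psi x).
Proof.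
move=> tphi tpsi.
have end0 chi : test_function U chi -> chi a = 0 /\ chi b = 0.
  by move=> tchi; split; apply: (test_out tchi); rewrite /= in_itv/= ltxx ?andbF.
have cL chi : test_function U chi ->
    {within `[a, b], continuous (derive1 chi)} /\ derivable_oo_LRcontinuous chi a b.
  move=> tchi; split.
    apply: continuous_subspaceT.
    exact/smooth_continuous/smooth_derive1/(test_smooth tchi).
  have cchi := smooth_continuous (test_smooth tchi); split.
  - by move=> x _; exact: smooth_derivable (test_smooth tchi).
  - exact: cvg_at_right_filter (cchi a).
  - exact: cvg_at_left_filter (cchi b).
have [c1 d1] := cL _ tphi; have [c2 d2] := cL _ tpsi.
have := Rintegration_by_parts ab c1 d1 (fun _ _ => erefl) c2 d2 (fun _ _ => erefl).
have [-> ->] := end0 _ tphi; rewrite !mul0r subrr sub0r.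
(* The classical formula integrates over [[a, b]]. The enlarged interval contains [b], so it
   provides integrability up to that endpoint before the endpoints are dropped. *)
have L2' chi : test_function U chi -> L2 `]a, b + 1[ chi by move=> tchi; exact: test_L2 tchi.
have cc f g : L2 `]a, b + 1[ f -> L2 `]a, b + 1[ g ->
    \int[leb]_(x in `[a, b]) (f x * g x) = \int[leb]_(x in U) (f x * g x).
  move=> fL gL; have fgi : itg `]a, b + 1[ (fun x => f x * g x) by exact: L2_itgM.
  rewrite Rintegral_itv_bndo_bndc ?Rintegral_itv_obnd_cbnd//.
    by apply: itgS fgi => //; apply: subset_itvl; rewrite bnd_simp ltrDl.
  by apply: itgS fgi => //; apply: subset_itvl; rewrite bnd_simp lerDl.
have dphiL := L2' _ (test_derive1 tphi); have dpsiL := L2' _ (test_derive1 tpsi).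
by rewrite (cc _ _ (L2' _ tphi) dpsiL) (cc _ _ dphiL (L2' _ tpsi)).
Qed.

Lemma test_weak_derivative phi : test_function U phi ->
  weak_derivative U 1 phi (derive1 phi).
Proof. by move=> tphi psi tpsi; rewrite expr1 mulN1r -test_by_parts. Qed.

Lemma wderivP n k u : Hk U n u -> (k <= n)%N ->
  L2 U (wderiv U k u) /\ weak_derivative U k u (wderiv U k u).
Proof. move=> [_ h] /h[w ww]; rewrite /wderiv.
by case: xgetP => [_ -> //|/(_ w)/(_ ww)].
Qed.

Lemma wderiv_eq k u w : L2 U u -> L2 U w -> weak_derivative U k u w ->
  L2 U (wderiv U k u) /\ ae_eq_on U (wderiv U k u) w.
Proof.
move=> uL wL uw.
have [dL ud] : L2 U (wderiv U k u) /\ weak_derivative U k u (wderiv U k u).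
  by rewrite /wderiv; case: xgetP => [_ -> //|/(_ w)/(_ (conj wL uw))].
by split => //; apply: wderiv_ae_unique ud uw _ => //; exact: ae_eq_on_refl.
Qed.

Lemma Hk_L2 n u : Hk U n u -> L2 U u. Proof. by case. Qed.

Lemma Hk_lin n (c : R) u v : Hk U n u -> Hk U n v -> Hk U n (fun x => c * u x + v x).
Proof.
move=> uH vH; have u2 := Hk_L2 uH; have v2 := Hk_L2 vH.
split => [|k kn]; first exact: L2_lin.
have [uL uw] := wderivP uH kn; have [vL vz] := wderivP vH kn.
exists (fun x => c * wderiv U k u x + wderiv U k v x); split; first exact: L2_lin.
exact: weak_derivative_lin.
Qed.

Lemma Hk_sub n u v : Hk U n u -> Hk U n v -> Hk U n (u \- v).
Proof.
move=> uH vH; have := Hk_lin (-1) vH uH; congr (Hk _ _ _).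
by apply/funext => x /=; ring.
Qed.

Lemma wderiv_lin n k (c : R) u v : Hk U n u -> Hk U n v -> (k <= n)%N ->
  ae_eq_on U (wderiv U k (fun x => c * u x + v x))
    (fun x => c * wderiv U k u x + wderiv U k v x).
Proof.
move=> uH vH kn; have [uL uw] := wderivP uH kn; have [vL vz] := wderivP vH kn.
have u2 := Hk_L2 uH; have v2 := Hk_L2 vH.
apply: (wderiv_eq _ _ _).2; [exact: L2_lin|exact: L2_lin|].
exact: weak_derivative_lin.
Qed.

Lemma wderivB n k u v : Hk U n u -> Hk U n v -> (k <= n)%N ->
  ae_eq_on U (wderiv U k (u \- v)) (wderiv U k u \- wderiv U k v).
Proof.
move=> uH vH kn; have := wderiv_lin (-1) vH uH kn.
rewrite (_ : (fun x => -1 * v x + u x) = u \- v); last first.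
  by apply/funext => x /=; ring.
by apply: filterS => x /= h Ux; rewrite h//; ring.
Qed.

(** Linearity of [wderiv] almost everywhere is enough, since the inner product ignores null sets.
    The case [k = 1] serves [H1], the case [k = 2] serves [H2star]. *)
Lemma wderiv_pre_hilbert n k : (k <= n)%N ->
  pre_hilbert (IPSpace (Hk U n) (fun u v => dot (L2 U) (wderiv U k u) (wderiv U k v))).
Proof.
move=> kn; have dL u : Hk U n u -> L2 U (wderiv U k u) by move=> /wderivP/(_ kn)[].
split => /=.
- exact: Hk_lin.
- by move=> u v uH vH; apply: (ph_sym phL2); exact: dL.
- move=> c u v w uH vH wH.
  rewrite -[RHS](ph_dotl phL2); try exact: dL.
  apply: ae_eq_dot => //.
  + by apply: dL; exact: Hk_lin.
  + by apply: L2_lin => //; exact: dL.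
  + exact: dL.
  + exact: dL.
  + exact: wderiv_lin vH kn.
  + exact: ae_eq_on_refl.
- by move=> u uH; apply: (ph_ge0 phL2); exact: dL.
Qed.

Lemma H1_pre_hilbert : pre_hilbert (H1 U).
Proof.
have p1 := @wderiv_pre_hilbert 1 1 isT.
have H1E u v : dot (H1 U) u v =
  dot (L2 U) u v + dot (L2 U) (wderiv U 1 u) (wderiv U 1 v) by [].
split.
- exact: (ph_lin p1).
- move=> u v uH vH; rewrite !H1E (ph_sym phL2 (Hk_L2 uH) (Hk_L2 vH)).
  have e := ph_sym p1 uH vH; rewrite [dot _ _ _]/= in e.
  by rewrite [X in _ + X = _]e.
- move=> c u v w uH vH wH; rewrite !H1E.
  have e := ph_dotl p1 c uH vH wH; rewrite [dot _ _ _]/= in e.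
  rewrite (ph_dotl phL2 c (Hk_L2 uH) (Hk_L2 vH) (Hk_L2 wH)) [X in _ + X = _]e.
  by rewrite mulrDr addrACA.
- move=> u uH; rewrite H1E; apply: addr_ge0; last exact: (ph_ge0 p1 uH).
  exact: (ph_ge0 phL2 (Hk_L2 uH)).
Qed.

Lemma test_Hk1 phi : test_function U phi -> Hk U 1 phi.
Proof.
move=> tphi; split=> [|[_|[_|//]]]; first exact: test_L2 tphi.
  by exists phi; split; [exact: test_L2 tphi|exact: weak_derivative0].
exists (derive1 phi); split; last exact: test_weak_derivative.
by apply: test_L2; exact: test_derive1 tphi.
Qed.

Lemma H10_lin (c : R) u v : H10 U u -> H10 U v -> H10 U (fun x => c * u x + v x).
Proof.
move=> [uH ud] [vH vd]; split; first exact: (ph_lin H1_pre_hilbert).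
(* The approximation of [u] gets multiplied by [c]; dividing by [|c| + 1] rather than [|c|] covers
   [c = 0]. *)
move=> e e0; have c0 : 0 < 2 * (`|c| + 1) by rewrite mulr_gt0// ltr_wpDl.
have [phi [tphi uphi]] := ud _ (divr_gt0 e0 c0).
have e2 : 0 < e / 2 by rewrite divr_gt0.
have [psi [tpsi vpsi]] := vd _ e2.
exists (fun x => c * phi x + psi x); split; first exact: test_lin.
have up := ph_sub H1_pre_hilbert uH (test_Hk1 tphi).
have vp := ph_sub H1_pre_hilbert vH (test_Hk1 tpsi).
rewrite (_ : _ \- _ = fun x => c * (u \- phi) x + (v \- psi) x); last first.
  by apply/funext => x /=; ring.
apply: le_lt_trans (ph_normD H1_pre_hilbert (ph_scale H1_pre_hilbert c up) vp) _.
rewrite (ph_normZ H1_pre_hilbert c up).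
move: (norm _ _) uphi (norm _ _) vpsi (ph_norm_ge0 (X := H1 U) (u \- phi)) => p pe q qe _.
have : `|c| * p <= e / 2.
  apply: le_trans (ler_wpM2l (normr_ge0 _) (ltW pe)) _.
  have c1 : 0 < `|c| + 1 by rewrite ltr_wpDl.
  have -> : `|c| * (e / (2 * (`|c| + 1))) = `|c| / (`|c| + 1) * (e / 2).
    by field; rewrite gt_eqF.
  by rewrite ler_piMl ?(ltW e2)// ler_pdivrMr// mul1r lerDl.
by move: qe; lra.
Qed.

Lemma H2star_pre_hilbert : pre_hilbert (H2star U).
Proof.
have p2 := @wderiv_pre_hilbert 2 2 isT; split.
- by move=> c u v [u1 u2] [v1 v2]; split; [exact: H10_lin|exact: Hk_lin].
- by move=> u v [_ u2] [_ v2]; exact: (ph_sym p2).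
- by move=> c u v w [_ u2] [_ v2] [_ w2]; exact: (ph_dotl p2).
- by move=> u [_ u2]; exact: (ph_ge0 p2).
Qed.

Lemma H10_approx u e : H10 U u -> 0 < e -> exists phi, [/\ test_function U phi,
  norm (L2 U) (u \- phi) < e & norm (L2 U) (wderiv U 1 u \- derive1 phi) < e].
Proof.
move=> [uH ud] e0; have [phi [tphi uphi]] := ud _ e0; exists phi.
have pL : L2 U phi by exact: test_L2 tphi.
have dpL : L2 U (derive1 phi) by apply: test_L2; exact: test_derive1 tphi.
have uL := Hk_L2 uH; have [duL uw] := wderivP uH (leqnn 1).
have Hup : Hk U 1 (u \- phi) := ph_sub H1_pre_hilbert uH (test_Hk1 tphi).
have [dL dE] := wderivP Hup (leqnn 1).
have dE' : norm (L2 U) (wderiv U 1 u \- derive1 phi) = norm (L2 U) (wderiv U 1 (u \- phi)).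
  apply: ae_eq_norm => //; first exact: ph_sub.
  apply: ae_eq_on_sym; apply: ae_eq_on_trans (wderivB uH (test_Hk1 tphi) (leqnn 1)) _.
  have [_] := wderiv_eq pL dpL (test_weak_derivative tphi).
  by apply: filterS => x /= h Ux; rewrite h.
split => //.
  apply: le_lt_trans uphi; apply: ler_wsqrtr; rewrite lerDl.
  exact: (ph_ge0 phL2).
rewrite dE'; apply: le_lt_trans uphi; apply: ler_wsqrtr; rewrite lerDr.
exact: (ph_ge0 phL2 (ph_sub phL2 uL pL)).
Qed.

End WeakDerivatives.

(** * Integration by parts and embeddings on a bounded interval *)

Section Embedding.
Context {R : realType}.
Local Notation leb := (@lebesgue_measure R).
Local Notation measR := (@measurable _ (measurableTypeR R)).
Local Notation mfunR := (@measurable_fun _ _ (measurableTypeR R) R).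
Variables (a b : R) (ab : a < b).
Local Notation U := (`]a, b[%classic : set R).
Implicit Types (f g phi psi u v w : R -> R).

Let mU : measR U. Proof. exact: measurable_itv. Qed.
Let phL2 : pre_hilbert (L2 U). Proof. exact: L2_pre_hilbert. Qed.

(** For a test function in place of [u] this is the definition of the weak derivative. Both sides
    are continuous in [u] for the H^1 norm, so it extends to [H10]; no boundary condition on [v]
    enters. *)
Lemma H10_dot_wderiv2 u v : H10 U u -> Hk U 2 v ->
  dot (L2 U) u (wderiv U 2 v) = - dot (L2 U) (wderiv U 1 u) (wderiv U 1 v).
Proof.
move=> u0 v2; have uL : L2 U u by case: u0 => /Hk_L2.
have [u1L _] := wderivP u0.1 (leqnn 1).
have [v1L vw1] := wderivP v2 (isT : (1 <= 2)%N); have [v2L vw2] := wderivP v2 (leqnn 2).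
have v12 := @weak_derivative_sub R a b 1 1 _ _ _ vw1 vw2.
apply/eqP; rewrite -addr_eq0 -normr_le0; apply/ler_addgt0Pr => e e0; rewrite add0r.
pose M := norm (L2 U) (wderiv U 2 v) + norm (L2 U) (wderiv U 1 v) + 1.
have M0 : 0 < M by rewrite ltr_wpDl// addr_ge0// ph_norm_ge0.
have [phi [tphi h0 h1]] := H10_approx ab u0 (divr_gt0 e0 M0).
have pL : L2 U phi by exact: test_L2 tphi.
have dpL : L2 U (derive1 phi) by apply: test_L2; exact: test_derive1 tphi.
have e1 : dot (L2 U) phi (wderiv U 2 v) + dot (L2 U) (derive1 phi) (wderiv U 1 v) = 0.
  rewrite (ph_sym phL2 pL v2L) (ph_sym phL2 dpL v1L).
  by have := v12 _ tphi => /= ->; rewrite expr1; ring.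
have -> : dot (L2 U) u (wderiv U 2 v) + dot (L2 U) (wderiv U 1 u) (wderiv U 1 v) =
    dot (L2 U) (u \- phi) (wderiv U 2 v) +
    dot (L2 U) (wderiv U 1 u \- derive1 phi) (wderiv U 1 v).
  rewrite (dotBl phL2 uL pL v2L) (dotBl phL2 u1L dpL v1L).
  by rewrite addrACA -opprD e1 oppr0 addr0.
have c0 := cauchy_schwarz phL2 (ph_sub phL2 uL pL) v2L.
have c1 := cauchy_schwarz phL2 (ph_sub phL2 u1L dpL) v1L.
apply: le_trans (ler_normD _ _) _; apply: le_trans (lerD c0 c1) _.
have n1 := ph_norm_ge0 (X := L2 U) (wderiv U 1 v).
have n2 := ph_norm_ge0 (X := L2 U) (wderiv U 2 v).
apply: le_trans (lerD (ler_wpM2r n2 (ltW h0)) (ler_wpM2r n1 (ltW h1))) _.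
by rewrite -mulrDr mulrAC ler_pdivrMr// ler_pM2l// /M lerDl.
Qed.

(** The operator uses [wderiv U 4], whereas the boundary condition concerns [wderiv U 2 u]; this
    connects the two. *)
Lemma wderiv4_ae u : H4star U u ->
  ae_eq_on U (wderiv U 4 u) (wderiv U 2 (wderiv U 2 u)).
Proof.
move=> [u4 _ [_ w2]].
have [u2L uw2] := wderivP u4 (isT : (2 <= 4)%N).
have [w2L ww2] := wderivP w2 (leqnn 2).
apply: (wderiv_eq (Hk_L2 u4) w2L _).2.
exact: (@weak_derivativeD _ _ _ 2 2 _ _ _ uw2 ww2).
Qed.

(** Two integrations by parts, each using one boundary condition: the first puts [v] in the [H10]
    position, the second puts [u_xx] there. *)
Lemma L_dot u v : H4star U u -> H2star U v ->
  dot (L2 U) (L U u) v = dot (H2star U) u v.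
Proof.
move=> uH [v0 v2]; have [u4 [u0 u2] [w0 w2]] := uH.
have vL := Hk_L2 v2; have [v2L _] := wderivP v2 (leqnn 2).
have [u2L _] := wderivP u2 (leqnn 2); have [w2L _] := wderivP w2 (leqnn 2).
have [w1L _] := wderivP w0.1 (leqnn 1); have [v1L _] := wderivP v0.1 (leqnn 1).
have [u4L _] := wderivP u4 (leqnn 4).
have -> : dot (L2 U) (L U u) v = dot (L2 U) (wderiv U 2 (wderiv U 2 u)) v.
  by apply: ae_eq_dot => //; [exact: wderiv4_ae|exact: ae_eq_on_refl].
rewrite (ph_sym phL2 w2L vL) (H10_dot_wderiv2 v0 w2).
rewrite (ph_sym phL2 v1L w1L) -(H10_dot_wderiv2 w0 v2).
by [].
Qed.

Lemma le_norm_ae f g : L2 U f -> L2 U g ->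
  {ae leb, forall x, U x -> `|f x| <= `|g x|} -> norm (L2 U) f <= norm (L2 U) g.
Proof.
move=> fL gL fg; apply: ler_wsqrtr.
apply: le_Rintegral_ae; [by []|exact: L2_itgM|exact: L2_itgM|].
apply: filterS fg => x /= h Ux; rewrite -!expr2 -(real_normK (num_real (f x))).
by rewrite -(real_normK (num_real (g x))) ler_sqr ?nnegrE// h.
Qed.

Lemma norm_cst (c : R) : norm (L2 U) (fun=> c) = `|c| * norm (L2 U) (fun=> 1).
Proof.
have := ph_normZ phL2 c (L2_cst a b 1).
by congr (norm _ _ = _); apply/funext => x; rewrite mulr1.
Qed.

(** Inside the interval, [phi x] is the integral of its derivative from [a]; Cauchy-Schwarz against
    the constant 1 gives the bound. The norm of that constant is the square root of [b - a]. *)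
Lemma test_sup phi x : test_function U phi ->
  `|phi x| <= norm (L2 U) (fun=> 1) * norm (L2 U) (derive1 phi).
Proof.
move=> tphi; have [xU|xU] := pselect (U x); last first.
  by rewrite (test_out tphi xU) normr0 mulr_ge0// ph_norm_ge0.
move: xU; rewrite /= in_itv/= => /andP[ax xb].
have tdphi := test_derive1 tphi; have cphi := smooth_continuous (test_smooth tphi).
have dL : L2 U (derive1 phi) by exact: test_L2 tdphi.
have di := L2_itg dL.
have dix : itg `]a, x] (derive1 phi).
  by apply: itgS di => //; apply: subset_itvl; rewrite bnd_simp.
have phia : phi a = 0 by apply: (test_out tphi); rewrite /= in_itv/= ltxx.
have ftc : (\int[leb]_(x in `[a, x]) (derive1 phi x)%:E = (phi x)%:E - (phi a)%:E)%E.
  apply: continuous_FTC2 => //.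
    exact/continuous_subspaceT/smooth_continuous/(test_smooth tdphi).
  split; [by move=> y _; exact: smooth_derivable (test_smooth tphi)|..].
    exact: cvg_at_right_filter (cphi a).
  exact: cvg_at_left_filter (cphi x).
have -> : phi x = \int[leb]_(x in `]a, x]) derive1 phi x.
  by rewrite Rintegral_itv_obnd_cbnd// /Rintegral ftc phia/= subr0.
have mI : measR `]a, x] by exact: measurable_itv.
have dnL : L2 U (fun x => `|derive1 phi x|) by exact: L2_normr.
apply: le_trans (le_normr_Rintegral mI dix) _.
apply: (@le_trans _ _ (\int[leb]_(x in U) `|derive1 phi x|)).
  apply: ge0_subset_Rintegral => //; first by apply: subset_itvl; rewrite bnd_simp.
  exact: itg_norm.
have := le_trans (ler_norm _) (cauchy_schwarz phL2 (L2_cst a b 1) dnL).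
rewrite norm_normr.
by congr (_ <= _); apply: eq_Rintegral => y _; rewrite mul1r.
Qed.

Local Notation s := (norm (L2 U) (fun=> 1)).

(** L^2 limits need not converge pointwise, so the supremum bound is not passed to the limit along a
    subsequence. Instead the excess [max (|u| - K) 0] is bounded by [|u - phi| + s * d], which is
    small in L^2, and hence has norm 0. *)
Lemma H10_sup u : H10 U u ->
  {ae leb, forall x, U x -> `|u x| <= s * norm (L2 U) (wderiv U 1 u)}.
Proof.
move=> u0; have uL := Hk_L2 u0.1; have [u1L _] := wderivP u0.1 (leqnn 1).
pose K := s * norm (L2 U) (wderiv U 1 u).
pose g x := Num.max (`|u x| - K) 0.
have s0 : 0 <= s by exact: ph_norm_ge0.
have K0 : 0 <= K by rewrite mulr_ge0// ph_norm_ge0.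
have mu : mfunR U u by exact: L2_measurable.
have mg : mfunR U g.
  apply: measurable_maxr => //; apply: measurable_funB => //.
  exact: measurableT_comp.
have g_le x (M : R) : `|u x| - K <= M -> 0 <= M -> `|g x| <= M.
  by move=> uM M0; rewrite ger0_norm /g ?le_max ?lexx ?orbT// ge_max uM.
have gL : L2 U g.
  apply/L2P => //; split => //; apply: (le_itg mU _ (L2_sqr mU uL)).
    exact: measurable_funX.
  move=> x _; rewrite normrX -(real_normK (num_real (u x))) ler_sqr ?nnegrE//.
  by apply: g_le => //; rewrite gerBl.
suff g0 : norm (L2 U) g = 0.
  apply: filterS (L2_norm0_ae mU gL g0) => x /= h Ux.
  by rewrite -/K -subr_le0 -(h Ux) /g le_max lexx.
apply/eqP; rewrite eq_le ph_norm_ge0 andbT; apply/ler_addgt0Pr => e e0; rewrite add0r.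
have c0 : 0 < 1 + s ^+ 2 by rewrite ltr_pwDl// sqr_ge0.
(* The error [d] occurs twice: in the L^2 distance to [phi], and through the constant [s * d], whose
   L^2 norm is [s * d * s]. *)
have [d d0 de] : exists2 d, 0 < d & e = d + s * d * s.
  exists (e / (1 + s ^+ 2)); first by rewrite divr_gt0.
  by move: (norm _ _) c0 => s1 c0; field; rewrite gt_eqF.
have [phi [tphi h0 h1]] := H10_approx ab u0 d0.
have pL : L2 U phi by exact: test_L2 tphi.
have dpL : L2 U (derive1 phi) by apply: test_L2; exact: test_derive1 tphi.
have dphi : norm (L2 U) (derive1 phi) <= norm (L2 U) (wderiv U 1 u) + d.
  have -> : derive1 phi = fun x => wderiv U 1 u x + (derive1 phi \- wderiv U 1 u) x.
    by apply/funext => x /=; ring.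
  apply: le_trans (ph_normD phL2 u1L (ph_sub phL2 dpL u1L)) _.
  by rewrite lerD2l (norm_distC phL2 dpL u1L) ltW.
have uphiL : L2 U (fun x => `|(u \- phi) x|) by apply: L2_normr => //; exact: ph_sub.
have hL : L2 U (fun x => `|(u \- phi) x| + s * d).
  by apply: (ph_add phL2) => //; exact: L2_cst.
apply: (@le_trans _ _ (norm (L2 U) (fun x => `|(u \- phi) x| + s * d))).
  apply: le_norm_ae => //; apply: aeW => x _.
  have M0 : 0 <= `|(u \- phi) x| + s * d by rewrite addr_ge0// mulr_ge0// ltW.
  rewrite [leRHS]ger0_norm//; apply: g_le => //.
  have u_phi : `|u x| <= `|(u \- phi) x| + `|phi x|.
    by rewrite -[in leLHS](subrK (phi x) (u x)); exact: ler_normD.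
  have := le_trans (test_sup x tphi) (ler_wpM2l s0 dphi).
  rewrite mulrDr -/K addrC => h; rewrite lerBlDr; apply: le_trans u_phi _.
  by rewrite -addrA lerD2l.
have := ph_normD phL2 uphiL (L2_cst a b (s * d)).
rewrite norm_normr (norm_cst (s * d)) ger0_norm ?mulr_ge0 ?(ltW d0)// => /le_trans; apply.
by rewrite de lerD2r ltW.
Qed.

Lemma H10_poincare u : H10 U u -> norm (L2 U) u <= s ^+ 2 * norm (L2 U) (wderiv U 1 u).
Proof.
move=> u0; have uL := Hk_L2 u0.1; have n0 := ph_norm_ge0 (X := L2 U).
have : norm (L2 U) u <= norm (L2 U) (fun=> s * norm (L2 U) (wderiv U 1 u)).
  apply: le_norm_ae => //; first exact: L2_cst.
  apply: filterS (H10_sup u0) => x h Ux; apply: le_trans (h Ux) _; exact: ler_norm.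
by rewrite norm_cst ger0_norm ?mulr_ge0// mulrAC -expr2.
Qed.

Lemma H2star_normE u : norm (H2star U) u = norm (L2 U) (wderiv U 2 u).
Proof. by []. Qed.

(** The second derivative alone controls everything: [|u_x|^2 = -(u, u_xx) <= |u| |u_xx|] and
    Poincare give [|u_x| <= s^2 |u_xx|], after division by [|u_x|] when it is nonzero. *)
Lemma H2star_embedding : exists2 K : R, 0 < K & forall u, H2star U u ->
  {ae leb, forall x, U x -> `|u x| <= K * norm (H2star U) u} /\
  norm (L2 U) u <= K * norm (H2star U) u.
Proof.
have s0 : 0 <= s by exact: ph_norm_ge0.
(* [s^3] comes from the supremum bound, [s^4] from Poincare, and 1 makes positivity immediate. *)
exists (s ^+ 3 + s ^+ 4 + 1); first by rewrite ltr_wpDl// addr_ge0// exprn_ge0.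
move=> u [u0 u2]; have uL := Hk_L2 u2; have [u2L _] := wderivP u2 (leqnn 2).
have [u1L _] := wderivP u0.1 (leqnn 1).
have sup := H10_sup u0; have poinc := H10_poincare u0.
rewrite H2star_normE.
have E : norm (L2 U) (wderiv U 1 u) ^+ 2 <=
    norm (L2 U) u * norm (L2 U) (wderiv U 2 u).
  rewrite (sqr_norm phL2 u1L) -[leLHS]opprK -(H10_dot_wderiv2 u0 u2).
  by apply: le_trans (ler_norm _) _; rewrite normrN; exact: cauchy_schwarz.
have := ph_norm_ge0 (X := L2 U) (wderiv U 2 u); have := ph_norm_ge0 (X := L2 U) (wderiv U 1 u).
move: (norm (L2 U) (wderiv U 1 u)) (norm (L2 U) (wderiv U 2 u)) (norm (L2 U) u) sup poinc E.
move: s s0 => t t0 n1 n2 n sup poinc E n1_0 n2_0.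
have n12 : n1 <= t ^+ 2 * n2.
  have [->|n1p] := eqVneq n1 0; first by rewrite mulr_ge0// exprn_ge0.
  have {}n1p : 0 < n1 by rewrite lt_neqAle eq_sym n1p.
  rewrite -(ler_pM2l n1p) -expr2; apply: le_trans E _.
  by rewrite mulrCA mulrA; apply: ler_wpM2r => //; rewrite mulrC.
have t2 : 0 <= t ^+ 2 by rewrite exprn_ge0.
have t3 : 0 <= t ^+ 3 by rewrite exprn_ge0.
have t4 : 0 <= t ^+ 4 by rewrite exprn_ge0.
split.
  apply: filterS sup => x h Ux; apply: le_trans (h Ux) _.
  apply: le_trans (ler_wpM2l t0 n12) _.
  by rewrite mulrA -exprS; apply: ler_wpM2r => //; lra.
apply: le_trans poinc _; apply: le_trans (ler_wpM2l t2 n12) _.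
by rewrite mulrA -exprD; apply: ler_wpM2r => //; lra.
Qed.

End Embedding.

(** * Scalar functions of time *)

Section RealLine.
Context {R : realType}.
Implicit Types (f F : R -> R) (t : R).

Lemma cvg_within_near (T : Type) (A : set_system R) (B : set R) (f : R -> T)
    (l : set_system T) : Filter A -> A B ->
  f @ within B A --> l -> f @ A --> l.
Proof.
by move=> FA AB h P /h; rewrite /nbhs/= /within/=; apply: filterS2 AB => x Bx; apply.
Qed.

Lemma nbhs_ge0 t : 0 < t -> \forall s \near t, 0 <= s.
Proof. by move=> t0; apply: filterS (lt_nbhsr t0) => s /ltW. Qed.

(** Right neighbours of [t] exist even at 0, so derivatives in time are unique up to the initial
    time. *)
Lemma ge0_punctured_proper t : 0 <= t ->
  ProperFilter (within [set s : R | 0 <= s /\ s != t] (nbhs t)).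
Proof.
move=> t0; split; last by exact: within_filter.
move/nbhs_ballP => [e /= e0 eP]; apply: (eP (t + e / 2)).
  rewrite /ball/= opprD addrA subrr sub0r normrN gtr0_norm ?divr_gt0//.
  by rewrite ltr_pdivrMr// mulr_natr mulr2n ltrDl.
have e2 : 0 < e / 2 by rewrite divr_gt0.
by split; [rewrite addr_ge0// ltW|rewrite gt_eqF// ltrDl].
Qed.

(** Only [x] is confined to the compact interval. This asymmetry lets a bounded state be compared
    with a nearby one without first bounding the latter. *)
Lemma compact_unif_continuous F (M e : R) : continuous F -> 0 < e ->
  exists2 d : R, 0 < d & forall x y, `|x| <= M -> `|x - y| <= d -> `|F x - F y| <= e.
Proof.
move=> cF e0; have cM : compact [set` `[- M, M]] by exact: segment_compact.
have := (compact_near_coveringP _).1 cM R (0^'+)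
  (fun d x => forall y, `|x - y| <= d -> `|F x - F y| <= e).
case/(_ _).
  move=> x _; have /cvgrPdist_lt/(_ (e / 2)) := cF x.
  rewrite divr_gt0// => /(_ isT)/nbhs_ballP[d /= d0 dF].
  exists (ball x (d / 2), [set r | r < d / 2]).
    split; first by apply: nbhsx_ballx; rewrite divr_gt0.
    by apply: nbhs_right_lt; rewrite divr_gt0.
  move=> [x' r] [/= xx' rd] y x'y.
  have h1 : `|F x - F x'| < e / 2.
    apply: dF; rewrite /ball/= (lt_trans xx')//.
    by rewrite ltr_pdivrMr// mulr_natr mulr2n ltrDl.
  have h2 : `|F x - F y| < e / 2.
    apply: dF; rewrite /ball/=.
    by move: xx' x'y rd; rewrite /ball/= !ltr_norml !ler_norml; lra.
  by move: h1 h2; rewrite !ltr_norml !ler_norml; lra.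
move=> d /= d0 dF; exists (d / 2); first by rewrite divr_gt0.
move=> x y xM xy; apply: (dF (d / 2)) => //=.
- by rewrite sub0r normrN gtr0_norm ?divr_gt0// ltr_pdivrMr// mulr_natr mulr2n ltrDl.
- by rewrite divr_gt0.
- by rewrite in_itv/= -ler_norml.
Qed.

Lemma is_derive_quotient f t (l : R) : 0 < t ->
  (f s - f t) / (s - t) @[s --> within [set s : R | 0 <= s /\ s != t] (nbhs t)] --> l ->
  is_derive t (1 : R) f l.
Proof.
move=> t0 h; apply/is_derive1_caratheodory.
exists (fun s => if s == t then l else (f s - f t) / (s - t)).
split; last by rewrite eqxx.
  move=> s; have [->|st] := eqVneq s t; first by rewrite !subrr mulr0.
  by rewrite divfK// subr_eq0.
rewrite /prop_for /continuous_at eqxx; apply/cvgrPdist_le => e e0.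
have /cvgrPdist_le/(_ e e0) := h; rewrite /within/=.
apply: filterS2 (nbhs_ge0 t0) => s s0 hs.
by have [_|st] := eqVneq s t; [rewrite subrr normr0 ltW|apply: hs].
Qed.

(** The product of [f] with [exp (c t)] is nonincreasing. Differentiability is asked for [t > 0]
    only, and one-sided continuity reaches [t = 0]. No sign of [c] is assumed: [c = 0] yields
    monotonicity of the energy. *)
Lemma gronwall f (f' : R -> R) (c : R) :
  (forall t, 0 < t -> is_derive t (1 : R) f (f' t)) ->
  (forall t, 0 <= t -> f s @[s --> within [set s | 0 <= s] (nbhs t)] --> f t) ->
  (forall t, 0 < t -> f' t <= - c * f t) ->
  forall t, 0 <= t -> f t <= f 0 * expR (- c * t).
Proof.
move=> df cf lef t t0.
pose W s := f s * expR (c * s).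
have dE (s : R) : is_derive s (1 : R) (fun s : R => expR (c * s)) (expR (c * s) * c).
  have h : is_derive s (1 : R) (fun s : R => c * s) c.
    by have := is_deriveZ c (is_derive_id s (1 : R)); rewrite /GRing.scale/= mulr1.
  exact: (@is_derive1_comp _ expR _ s _ _ (is_derive_expR _) h).
have dW (s : R) : 0 < s -> is_derive s (1 : R) W ((f' s + c * f s) * expR (c * s)).
  move=> s0; have := is_deriveM (df s s0) (dE s).
  by move=> h; apply: (is_derive_eq h); rewrite /GRing.scale/=; ring.
suff : W t <= W 0.
  by rewrite /W mulr0 expR0 mulr1 mulNr expRN ler_pdivlMr// expR_gt0.
have [->//|tn0] := eqVneq t 0.
have {}t0 : 0 < t by rewrite lt_neqAle eq_sym tn0.
apply: (@ler0_derive1_le_cc _ W 0 t) => //.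
- move=> s; rewrite in_itv/= => /andP[s0 _].
  exact: (@ex_derive _ _ _ _ _ _ _ (dW s s0)).
- move=> s; rewrite in_itv/= => /andP[s0 _].
  rewrite derive1E (@derive_val _ _ _ _ _ _ _ (dW s s0)).
  apply: mulr_le0_ge0; last exact: expR_ge0.
  by have := lef s s0; lra.
- apply/subspace_continuousP => s /=; rewrite in_itv/= => /andP[s0 _].
  apply: cvgM.
    apply: cvg_trans (cf s s0); apply: cvg_app; apply: within_subset.
    by move=> r /=; rewrite in_itv/= => /andP[].
  have ce : {for s, continuous (fun r : R => expR (c * r))}.
    by apply: differentiable_continuous; apply/derivable1_diffP; case: (dE s).
  exact: cvg_within_filter ce.
- by rewrite in_itv/= lexx ltW.
- by rewrite in_itv/= lexx ltW.
- exact: ltW.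
Qed.

End RealLine.

(** * Evolutions in time *)

Section TimeDerivatives.
Context {R : realType}.
Local Notation leb := (@lebesgue_measure R).
Local Notation measR := (@measurable _ (measurableTypeR R)).
Local Notation mfunR := (@measurable_fun _ _ (measurableTypeR R) R).
Variables (a b : R) (ab : a < b).
Local Notation U := (`]a, b[%classic : set R).
Implicit Types (f g h : R -> R) (u v w : R -> R -> R) (t : R).

Let mU : measR U. Proof. exact: measurable_itv. Qed.
Let phL2 : pre_hilbert (L2 U). Proof. exact: L2_pre_hilbert. Qed.
Let phH2 : pre_hilbert (H2star U). Proof. exact: H2star_pre_hilbert. Qed.

Lemma quotient_ae u v s t : ae_eq_on U (u s) (v s) -> ae_eq_on U (u t) (v t) ->
  ae_eq_on U (fun x => (u s x - u t x) / (s - t)) (fun x => (v s x - v t x) / (s - t)).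
Proof. by move=> us ut; apply: filterS2 us ut => x /= h1 h2 Ux; rewrite h1// h2. Qed.

Lemma L2_quotient f g (c : R) : L2 U f -> L2 U g -> L2 U (fun x => (f x - g x) / c).
Proof.
move=> fL gL; have := ph_scale phL2 c^-1 (ph_sub phL2 fL gL).
by congr (carrier _ _); apply/funext => x; rewrite mulrC.
Qed.

Lemma has_derivative_ae u v t g h : 0 <= t ->
  (forall s, 0 <= s -> L2 U (u s)) -> (forall s, 0 <= s -> L2 U (v s)) ->
  (forall s, 0 <= s -> ae_eq_on U (u s) (v s)) -> L2 U h -> ae_eq_on U g h ->
  has_derivative (L2 U) u t g -> has_derivative (L2 U) v t h.
Proof.
move=> t0 uL vL uv hL gh [gL cg]; split => //.
apply: cvg_trans cg; apply: near_eq_cvg.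
apply: (@filterS _ _ _ _ _ _ (withinT [set s : R | 0 <= s /\ s != t] _)) => s [s0 _].
apply: ae_eq_norm.
- by apply: (ph_sub phL2) => //; apply: L2_quotient; [exact: uL|exact: uL].
- by apply: (ph_sub phL2) => //; apply: L2_quotient; [exact: vL|exact: vL].
- apply: filterS2 gh (quotient_ae (uv s s0) (uv t t0)) => x /= h1 h2 Ux.
  by rewrite h2// h1.
Qed.

Lemma has_derivative_unique u t g h : 0 <= t -> (forall s, 0 <= s -> L2 U (u s)) ->
  has_derivative (L2 U) u t g -> has_derivative (L2 U) u t h -> ae_eq_on U g h.
Proof.
move=> t0 uL [gL cg] [hL ch]; apply: dist_eq_ae_L2 => //.
apply/eqP; rewrite eq_le ph_norm_ge0 andbT; apply/ler_addgt0Pr => e e0; rewrite add0r.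
have PA := ge0_punctured_proper t0.
have e2 : 0 < e / 2 by rewrite divr_gt0.
have /cvgr0Pnorm_le/(_ _ e2) ng := cg; have /cvgr0Pnorm_le/(_ _ e2) nh := ch.
have nA : \forall s \near within [set s : R | 0 <= s /\ s != t] (nbhs t), 0 <= s /\ s != t.
  exact: withinT.
have [s [[hg hh] [s0 _]]] := filter_ex (filterI (filterI ng nh) nA).
have qL : L2 U (fun x => (u s x - u t x) / (s - t)) by apply: L2_quotient; exact: uL.
apply: le_trans (ph_dist_triangle phL2 gL qL hL) _.
rewrite (norm_distC phL2 gL qL) [e]splitr; apply: lerD.
  by apply: le_trans hg; exact: ler_norm.
by apply: le_trans hh; exact: ler_norm.
Qed.

Lemma H2star_L2 f : H2star U f -> L2 U f. Proof. by case=> _ /Hk_L2. Qed.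

Lemma cvg_H2star_L2 (T : Type) (A : set_system T) (FA : Filter A) (p : T -> R -> R) :
  (\forall s \near A, H2star U (p s)) ->
  norm (H2star U) (p s) @[s --> A] --> 0 -> norm (L2 U) (p s) @[s --> A] --> 0.
Proof.
have [K K0 HK] := H2star_embedding ab => Hp cp.
have c : K * norm (H2star U) (p s) @[s --> A] --> 0.
  by rewrite -(mulr0 K); apply: cvgM => //; exact: cvg_cst.
apply: squeeze_cvgr (cvg_cst 0) c; apply: filterS Hp => s Hs.
by rewrite ph_norm_ge0/=; case: (HK _ Hs).
Qed.

Lemma H2star_has_derivative_L2 u t g : 0 <= t -> (forall s, 0 <= s -> H2star U (u s)) ->
  has_derivative (H2star U) u t g -> has_derivative (L2 U) u t g.
Proof.
move=> t0 uH [gH cg]; split; first exact: H2star_L2.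
have nA : \forall s \near within [set s : R | 0 <= s /\ s != t] (nbhs t), 0 <= s /\ s != t.
  exact: withinT.
apply: cvg_H2star_L2 cg; apply: filterS nA => s [s0 _].
have := ph_sub phH2 (ph_scale phH2 (s - t)^-1 (ph_sub phH2 (uH s s0) (uH t t0))) gH.
by congr (carrier _ _); apply/funext => x /=; rewrite mulrC.
Qed.

Lemma Dt_spec u t g : has_derivative (L2 U) u t g -> has_derivative (L2 U) u t (Dt U u t).
Proof. by move=> ug; rewrite /Dt; case: xgetP => [_ -> //|/(_ g)/(_ ug)]. Qed.

Lemma C0_H2star_L2 u : C0 (H2star U) u -> C0 (L2 U) u.
Proof.
move=> cu t t0; have [uH cut] := cu t t0; split; first exact: H2star_L2.
have nA : \forall s \near within [set s : R | 0 <= s] (nbhs t), 0 <= s by exact: withinT.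
apply: cvg_H2star_L2 cut; apply: filterS nA => s s0.
by apply: (ph_sub phH2) => //; case: (cu s s0).
Qed.

End TimeDerivatives.

(** * Regular representatives of the time derivatives and composition with a continuous function *)

Section Evolution.
Context {R : realType}.
Local Notation leb := (@lebesgue_measure R).
Local Notation measR := (@measurable _ (measurableTypeR R)).
Local Notation mfunR := (@measurable_fun _ _ (measurableTypeR R) R).
Variables (a b : R) (ab : a < b).
Local Notation U := (`]a, b[%classic : set R).
Implicit Types (f g h : R -> R) (u v w : R -> R -> R) (t : R).

Let mU : measR U. Proof. exact: measurable_itv. Qed.
Let phL2 : pre_hilbert (L2 U). Proof. exact: L2_pre_hilbert. Qed.
Let phH2 : pre_hilbert (H2star U). Proof. exact: H2star_pre_hilbert. Qed.

(** [Dt U u] is only an L^2 choice. Here [v] is a velocity given with values in [H2star], so that it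
    may be paired with [L] by [L_dot], and [w] is its derivative in [L2]. *)
Record evolution u v w : Prop := Evolution {
  ev_H4 : C0 (H4star U) u ;
  ev_H2 : C0 (H2star U) u ;
  ev_v : C0 (H2star U) v ;
  ev_w : C0 (L2 U) w ;
  ev_du : forall t, 0 <= t -> has_derivative (H2star U) u t (v t) ;
  ev_dv : forall t, 0 <= t -> has_derivative (L2 U) v t (w t) }.

(** A solution comes with three candidates for the velocity: [v] from C^1 in [H2star], [v'] from C^2
    in [L2], and [Dt U u]. The embedding makes all of them L^2 derivatives of [u], hence equal
    almost everywhere at each time, and the second derivative is transported along these
    equalities. *)
Lemma solution_evolution F G (f u : R -> R -> R) (u0 u1 : R -> R) :
  pseudo_classical_solution U F G f u0 u1 u ->
  exists v w, evolution u v w /\ forall t, 0 <= t ->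
    (L2 U (Dt U u t) /\ ae_eq_on U (Dt U u t) (v t)) /\
    (L2 U (Dt U (Dt U u) t) /\ ae_eq_on U (Dt U (Dt U u) t) (w t)).
Proof.
move=> [[cu [cuH [v [duv [cv _]]]] [cuL [v' [duv' [cv' [w [dvw [cw _]]]]]]]] _].
have uL t : 0 <= t -> L2 U (u t) by move=> /cuL[].
have uH t : 0 <= t -> H2star U (u t) by move=> /cuH[].
have vL t : 0 <= t -> L2 U (v t) by move=> /duv[/H2star_L2].
have v'L t : 0 <= t -> L2 U (v' t) by move=> /duv'[].
have wL t : 0 <= t -> L2 U (w t) by move=> /dvw[].
have duD t : 0 <= t -> has_derivative (L2 U) u t (Dt U u t).
  by move=> t0; apply: Dt_spec; exact: duv'.
have DL t : 0 <= t -> L2 U (Dt U u t) by move=> /duD[].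
have Dv t : 0 <= t -> ae_eq_on U (Dt U u t) (v t).
  move=> t0; apply: (has_derivative_unique t0 uL) (duD t t0) _.
  exact: (H2star_has_derivative_L2 ab t0 uH (duv t t0)).
have Dv' t : 0 <= t -> ae_eq_on U (Dt U u t) (v' t).
  by move=> t0; apply: (has_derivative_unique t0 uL) (duD t t0) _; exact: duv'.
have dDw t : 0 <= t -> has_derivative (L2 U) (Dt U u) t (w t).
  move=> t0; apply: (has_derivative_ae t0 v'L DL _ (wL t t0) (ae_eq_on_refl _ _)) (dvw t t0).
  by move=> s s0; apply: ae_eq_on_sym; exact: Dv'.
have dDD t : 0 <= t -> has_derivative (L2 U) (Dt U u) t (Dt U (Dt U u) t).
  by move=> t0; apply: Dt_spec; exact: dDw.
exists v, w; split.
  apply: Evolution; [exact: cu|exact: cuH|exact: cv|exact: cw|exact: duv|].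
  move=> t t0; apply: (has_derivative_ae t0 DL vL Dv (wL t t0) (ae_eq_on_refl _ _)).
  exact: dDw.
move=> t t0; split; first by split; [exact: DL|exact: Dv].
by split; [case: (dDD t t0)|exact: (has_derivative_unique t0 DL (dDD t t0) (dDw t t0))].
Qed.

Lemma L2_ae_bounded f (M : R) : mfunR U f ->
  {ae leb, forall x, U x -> `|f x| <= M} -> L2 U f.
Proof.
move=> mf fM; apply/L2P => //; split => //; apply/integrableP; split.
  by apply/measurable_EFinP; exact: measurable_funX.
have /integrableP[_] := finite_itg_cst a b (M ^+ 2); apply: le_lt_trans.
apply: ae_ge0_le_integral => //.
- by apply/measurable_EFinP/measurableT_comp => //; exact: measurable_funX.
- apply: filterS fM => x /= h Ux; rewrite lee_fin normrX [leRHS]ger0_norm ?sqr_ge0//.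
  by rewrite ler_sqr ?nnegrE// ?h// (le_trans _ (h Ux)).
Qed.

Lemma measurable_comp_continuous (F : R -> R) f :
  continuous F -> mfunR U f -> mfunR U (F \o f).
Proof.
move=> cF mf; apply: (measurableT_comp _ mf).
exact: continuous_measurable_fun.
Qed.

(** By the embedding [g] takes almost all its values in a compact interval, on which [F] is
    bounded. *)
Lemma L2_comp (F : R -> R) g : continuous F -> H2star U g -> L2 U (F \o g).
Proof.
move=> cF gH; have [K K0 /(_ g gH)[gK _]] := H2star_embedding ab.
pose M := K * norm (H2star U) g.
have /compact_bounded[B [_ HB]] : compact (F @` [set` `[- M, M]]).
  by apply: continuous_compact; [exact: continuous_subspaceT|exact: segment_compact].
apply: (@L2_ae_bounded _ (`|B| + 1)).
  by apply: measurable_comp_continuous => //; exact: L2_measurable (H2star_L2 gH).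
apply: filterS gK => x /= h Ux; apply: (HB (`|B| + 1)).
  by rewrite (le_lt_trans (ler_norm B)) ?ltrDl.
by exists (g x) => //; rewrite /= in_itv/= -ler_norml h.
Qed.

(** Convergence in [H2star] is essentially uniform in space, so uniform continuity of [F] near the
    values of [v t] applies; a uniform error of [e / (n1 + 1)] has L^2 norm at most [e]. *)
Lemma cvg_L2_comp (F : R -> R) v t : continuous F -> C0 (H2star U) v -> 0 <= t ->
  norm (L2 U) ((F \o v s) \- (F \o v t)) @[s --> within [set s | 0 <= s] (nbhs t)] --> 0.
Proof.
move=> cF cv t0; have [vH cvt] := cv t t0.
have [K K0 HK] := H2star_embedding ab.
apply/cvgr0Pnorm_le => e e0.
pose n1 := norm (L2 U) (fun=> 1).
have n10 : 0 <= n1 := ph_norm_ge0 _.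
have e1 : 0 < e / (n1 + 1) by rewrite divr_gt0// ltr_wpDl.
have [d d0 dF] := compact_unif_continuous (K * norm (H2star U) (v t)) cF e1.
have /cvgr0Pnorm_le/(_ _ (divr_gt0 d0 K0)) := cvt.
have nA : \forall s \near within [set s : R | 0 <= s] (nbhs t), 0 <= s by exact: withinT.
apply: filterS2 nA => s s0 nd.
have [vsH _] := cv s s0.
have [vtK _] := HK _ vH; have [vstK _] := HK _ (ph_sub phH2 vsH vH).
rewrite ger0_norm ?ph_norm_ge0//.
apply: (@le_trans _ _ (norm (L2 U) (fun=> e / (n1 + 1)))).
  apply: le_norm_ae => //.
  - have h := ph_sub phL2 (L2_comp cF vsH) (L2_comp cF vH). exact h.
  - exact: L2_cst.
  apply: filterS2 vtK vstK => x /= h1 h2 Ux; rewrite [leRHS]gtr0_norm// distrC.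
  apply: dF; first exact: h1.
  rewrite distrC; apply: le_trans (h2 Ux) _; rewrite -ler_pdivlMl// mulrC.
  by apply: le_trans nd; exact: ler_norm.
rewrite (norm_cst _ _ (e / (n1 + 1))) gtr0_norm// -/n1 mulrAC ler_pdivrMr ?ltr_wpDl//.
by rewrite ler_pM2l// lerDl.
Qed.

Lemma cvg_L_dot u g t : C0 (H4star U) u -> L2 U g -> 0 < t ->
  dot (L2 U) (L U (u s)) g @[s --> t] --> dot (L2 U) (L U (u t)) g.
Proof.
move=> cu gL t0.
have LL s : 0 <= s -> L2 U (L U (u s)).
  by move=> /cu[[u4 _ _] _]; case: (wderivP u4 (leqnn 4)).
have nA := nbhs_ge0 t0; have tt := ltW t0.
apply: (cvg_dot phL2 (LL t tt) gL).
- by apply: filterS nA => s; exact: LL.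
- exact: nearW.
- have [_ cut] := cu t tt; apply: (@cvg_within_near _ _ (nbhs t) [set s | 0 <= s] _ _ _ nA).
  apply: cvg_trans cut; apply: near_eq_cvg.
  have nA' : \forall s \near within [set s : R | 0 <= s] (nbhs t), 0 <= s by exact: withinT.
  apply: filterS nA' => s s0.
  have [[us4 _ _] _] := cu s s0; have [[ut4 _ _] _] := cu t tt.
  have [dL _] := wderivP (Hk_sub us4 ut4) (leqnn 4).
  rewrite (_ : norm (H4star U) _ = norm (L2 U) (wderiv U 4 (u s \- u t)))//.
  apply: ae_eq_norm => //; first by apply: (ph_sub phL2); exact: LL.
  exact: wderivB us4 ut4 _.
- rewrite (_ : (fun s => _) = fun=> 0); first exact: cvg_cst.
  apply/funext => s; rewrite /norm (dotBl phL2)//; last exact: ph_sub.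
  by rewrite subrr sqrtr0.
Qed.

End Evolution.

(** * From the equation weak in time to the equation at each positive time *)

Section Equation.
Context {R : realType}.
Local Notation leb := (@lebesgue_measure R).
Local Notation measR := (@measurable _ (measurableTypeR R)).
Local Notation mfunR := (@measurable_fun _ _ (measurableTypeR R) R).

Lemma Rintegral_test (c d : R) (V : set R) (phi g : R -> R) :
  `]c, d[%classic `<=` V -> test_function `]c, d[ phi ->
  \int[leb]_(x in V) (g x * phi x) = \int[leb]_(x in `]c, d[) (g x * phi x).
Proof.
move=> VS tphi; rewrite Rintegral_mkcond [RHS]Rintegral_mkcond.
apply: eq_Rintegral => x _; rewrite /patch.
case: ifPn => xV; case: ifPn => xI //.
  have nI : ~ `]c, d[%classic x by move=> xI'; move: xI; rewrite mem_set.
  by rewrite (test_out tphi nI) mulr0.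
by move: xV; rewrite mem_set//; apply: VS; move: xI; rewrite inE.
Qed.

Lemma itg_continuous (c d : R) (g : R -> R) :
  {in `[c, d], continuous g} -> itg `]c, d[ g.
Proof.
move=> cg; apply: (@itgS _ `[c, d]) => //; first exact: subset_itv_oo_cc.
apply: continuous_compact_integrable; first exact: segment_compact.
by apply: continuous_in_subspaceT => x; rewrite inE => /cg.
Qed.

Lemma weak_eq_pointwise (A B : R -> R) :
  (forall t : R, 0 < t -> {for t, continuous A}) ->
  (forall t : R, 0 < t -> {for t, continuous B}) ->
  (forall phi, test_function `]0, +oo[ phi ->
    \int[leb]_(t in `]0, +oo[) (A t * phi t) =
    - \int[leb]_(t in `]0, +oo[) (B t * phi t)) ->
  forall t : R, 0 < t -> A t = - B t.
Proof.
move=> cA cB AB t t0; apply/eqP; rewrite -addr_eq0; apply/eqP.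
(* Localization to []t / 2, t + 1[]: its closure is compact and avoids 0, so [A] and [B], continuous
   at positive times, are integrable there. *)
have c0 : 0 < t / 2 by rewrite divr_gt0.
have Ii (g : R -> R) : (forall t : R, 0 < t -> {for t, continuous g}) -> itg `]t / 2, t + 1[ g.
  move=> cg; apply: itg_continuous => s; rewrite in_itv/= => /andP[ts _].
  by apply: cg; exact: lt_le_trans ts.
have mI : measR `]t / 2, t + 1[ by exact: measurable_itv.
apply: (@test_eq0_pt _ (t / 2) (t + 1) (fun s => A s + B s)).
- by apply: itgD => //; exact: Ii.
- move=> phi tphi.
  have S0 : `]t / 2, t + 1[%classic `<=` `]0, +oo[%classic.
    by move=> s /=; rewrite !in_itv/= andbT => /andP[ts _]; exact: lt_trans ts.
  have := AB _ (test_subset S0 tphi); rewrite !(Rintegral_test _ S0 tphi) => e.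
  have -> : \int[leb]_(s in `]t / 2, t + 1[) ((A s + B s) * phi s) =
      \int[leb]_(s in `]t / 2, t + 1[) (A s * phi s) +
      \int[leb]_(s in `]t / 2, t + 1[) (B s * phi s).
    rewrite -RintegralD//; first by apply: eq_Rintegral => s _; rewrite mulrDl.
      exact: test_itgM mI tphi (Ii _ cA).
    exact: test_itgM mI tphi (Ii _ cB).
  by rewrite e addNr.
- by rewrite in_itv/= ltr_pdivrMr// ltr_pMr// ltr1n ltrDl ltr01.
- exact: cvgD (cA t t0) (cB t t0).
Qed.

Variables (a b : R) (ab : a < b).
Local Notation U := (`]a, b[%classic : set R).

Let mU : measR U. Proof. exact: measurable_itv. Qed.
Let phL2 : pre_hilbert (L2 U). Proof. exact: L2_pre_hilbert. Qed.

Lemma cvg_dot_cst (u : R -> R -> R) (z : R -> R) (t : R) : 0 < t ->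
  (forall s : R, 0 <= s -> L2 U (u s)) -> L2 U z ->
  norm (L2 U) (u s \- u t) @[s --> within [set s | 0 <= s] (nbhs t)] --> 0 ->
  {for t, continuous (fun s => dot (L2 U) (u s) z)}.
Proof.
move=> t0 uL zL cu; apply: (cvg_dot phL2 (uL t (ltW t0)) zL).
- by apply: filterS (nbhs_ge0 t0) => s; exact: uL.
- exact: nearW.
- exact: (@cvg_within_near _ _ (nbhs t) [set s | 0 <= s] _ _ _ (nbhs_ge0 t0) cu).
- rewrite (_ : (fun s => _) = fun=> 0); first exact: cvg_cst.
  apply/funext => s; rewrite /norm (dotBl phL2)//; last exact: ph_sub.
  by rewrite subrr sqrtr0.
Qed.

(** The function [z] is fixed while time varies, but the conclusion holds at every [t > 0]; it may
    afterwards be used at time [t] with [z = v t] or [z = u t]. *)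
Lemma solution_pointwise (F G : R -> R) (f u v w : R -> R -> R) (u0 u1 z : R -> R) :
  continuous F -> (forall y, G y = 0) -> C0 (L2 U) f ->
  (forall t : R, 0 <= t -> ae_eq_on U (f t) (cst 0)) ->
  pseudo_classical_solution U F G f u0 u1 u ->
  evolution a b u v w ->
  (forall t : R, 0 <= t ->
    (L2 U (Dt U u t) /\ ae_eq_on U (Dt U u t) (v t)) /\
    (L2 U (Dt U (Dt U u) t) /\ ae_eq_on U (Dt U (Dt U u) t) (w t))) ->
  L2 U z -> forall t : R, 0 < t ->
  dot (L2 U) (w t) z = - (dot (L2 U) (L U (u t)) z + dot (L2 U) (F \o v t) z).
Proof.
move=> cF G0 fC f0 [_ [_ _ weak]] ev Dvw zL.
have cw := ev_w ev; have cv := ev_v ev; have cu := ev_H4 ev.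
have wL s : 0 <= s -> L2 U (w s) by move=> /cw[].
have FvL s : 0 <= s -> L2 U (F \o v s) by move=> /cv[vs _]; exact: L2_comp.
have Ige0 (t : R) : t \in `]0, +oo[%classic -> 0 <= t.
  by rewrite inE/= in_itv/= andbT => /ltW.
apply: weak_eq_pointwise.
- move=> t t0; exact: (cvg_dot_cst t0 wL zL (cw t (ltW t0)).2).
- move=> t t0; apply: cvgD; first exact: cvg_L_dot.
  apply: (@cvg_dot_cst (fun s => F \o v s)) => //.
  exact: (cvg_L2_comp ab cF cv (ltW t0)).
- move=> phi tphi; have := weak phi z tphi zL.
  rewrite (_ : \int[leb]_(t in `]0, +oo[) (dot (L2 U) (Dt U (Dt U u) t) z * phi t) =
    \int[leb]_(t in `]0, +oo[) (dot (L2 U) (w t) z * phi t)); last first.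
    apply: eq_Rintegral => t tI; have {tI}t0 := Ige0 t tI.
    have [_ [DL Dw]] := Dvw t t0.
    by rewrite (ae_eq_dot mU DL (wL t t0) zL zL Dw (ae_eq_on_refl _ _)).
  move=> ->; congr (- _); apply: eq_Rintegral => t tI.
  have {tI}t0 := Ige0 t tI; congr (_ * _).
  have [[DL Dv] _] := Dvw t t0.
  have FDv : ae_eq_on U (F \o v t) (F \o Dt U u t).
    by apply: filterS Dv => x /= h Ux; rewrite h.
  have FDL : L2 U (F \o Dt U u t).
    apply: (ae_eq_L2 mU (FvL t t0) _ FDv).
    by apply: measurable_comp_continuous => //; exact: L2_measurable.
  have z0 : L2 U (cst 0) by exact: L2_cst.
  have dot0 : dot (L2 U) (cst 0) z = 0.
    have := dotBl phL2 z0 z0 zL; rewrite subrr.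
    have -> // : (cst 0 \- cst 0 : R -> R) = cst 0.
    by apply/funext => x /=; rewrite subrr.
  have fL : L2 U (f t) by case: (fC t t0).
  rewrite (ae_eq_dot mU fL z0 zL zL (f0 t t0) (ae_eq_on_refl _ _)) dot0 subr0.
  have -> : G \o u t = cst 0 by apply/funext => x /=; rewrite G0.
  rewrite dot0 addr0; congr (_ + _).
  by rewrite (ae_eq_dot mU (FvL t t0) FDL zL zL FDv (ae_eq_on_refl _ _)).
Qed.

End Equation.

(** * The scalar differential inequality behind the decay *)

Section Decay.
Context {R : realType}.

(** The bound with [K] makes the perturbed energy comparable to the energy, the one with [B] lets
    half of the dissipation absorb the cross term, and [eps <= a] lets the other half control the
    kinetic part. *)
Lemma small_parameter (a K B : R) : 0 < a -> 0 < K -> 0 <= B ->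
  exists eps : R, [/\ 0 < eps, eps * K <= 2^-1, eps * B <= 2^-1 & eps <= a].
Proof.
move=> a0 K0 B0; have ai0 : 0 < a^-1 by rewrite invr_gt0.
have A0 : 0 < K + B + a^-1 by lra.
exists (2 * (K + B + a^-1))^-1; split.
- by rewrite invr_gt0 mulr_gt0.
- by rewrite mulrC ler_pdivrMr ?mulr_gt0//; lra.
- by rewrite mulrC ler_pdivrMr ?mulr_gt0//; lra.
- rewrite -[leRHS]invrK lef_pV2 ?posrE ?mulr_gt0//; lra.
Qed.

(** Here [r] stands for [|u'|], [q] for [|u_xx|], [D] for [(F(u'), u')], [N] for [(F(u'), u)] and
    [p] for [(u', u)]. The bound on [N] is kept open in [M], because the uniform value of [M] is
    known only after the energy is shown to decrease. *)
Lemma perturbed_energy_decay (a1 a2 K : R) (r q D N p : R -> R) :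
  0 < a1 -> 0 < a2 -> 0 < K ->
  (forall t, 0 <= r t) -> (forall t, 0 <= q t) ->
  (forall t : R, 0 < t ->
    is_derive t (1 : R) (fun s => (r s ^+ 2 + q s ^+ 2) / 2) (- D t)) ->
  (forall t : R, 0 < t -> is_derive t (1 : R) p (r t ^+ 2 - q t ^+ 2 - N t)) ->
  (forall t : R, 0 <= t -> (r s ^+ 2 + q s ^+ 2) / 2
    @[s --> within [set s | 0 <= s] (nbhs t)] --> (r t ^+ 2 + q t ^+ 2) / 2) ->
  (forall t : R, 0 <= t -> p s @[s --> within [set s | 0 <= s] (nbhs t)] --> p t) ->
  (forall t : R, 0 < t -> a1 * r t ^+ 2 <= D t) ->
  (forall t : R, 0 <= t -> `|p t| <= K * r t * q t) ->
  (forall (t M : R), 0 < t -> K * q t <= M ->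
    `|N t| <= 2 * a2 * (K * r t * q t) + M * D t) ->
  exists C c : R, [/\ 0 < C, 0 < c &
    forall t : R, 0 <= t -> r t <= C * expR (- c * t) /\ q t <= C * expR (- c * t)].
Proof.
move=> a10 a20 K0 r0 q0 de dp ce cp aD pK NM.
pose e t := (r t ^+ 2 + q t ^+ 2) / 2.
have e0 t : 0 <= e t by rewrite divr_ge0// addr_ge0// sqr_ge0.
have e_le t : 0 <= t -> e t <= e 0.
  move=> t0; have := gronwall (c := 0) de ce.
  rewrite oppr0 => /(_ _ t t0); rewrite mul0r expR0 mulr1; apply => s s0.
  rewrite mul0r oppr_le0; apply: le_trans (aD s s0).
  by rewrite mulr_ge0 ?sqr_ge0// ltW.
(* Since [q^2 <= 2 e <= 2 e 0], this bounds [K * q], and so the supremum of [u], at all times. *)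
pose M := K * Num.sqrt (2 * e 0).
have M0 : 0 <= M by rewrite mulr_ge0 ?sqrtr_ge0// ltW.
have qM t : 0 <= t -> K * q t <= M.
  move=> t0; rewrite /M ler_pM2l// -[q t]ger0_norm ?q0// -sqrtr_sqr.
  apply: ler_wsqrtr; have := e_le t t0; have := sqr_ge0 (r t); rewrite {1}/e; lra.
(* [B * D] collects the terms of [p'] that have to be absorbed: [M * D] from the large velocities,
   [r^2] itself, and the part [2 a2^2 K^2 r^2] left when [2 a2 K r q] gives up [q^2 / 2]; the last
   two are bounded through [a1 * r^2 <= D]. *)
pose B := M + (1 + 2 * a2 ^+ 2 * K ^+ 2) / a1.
have B0 : 0 <= B.
  by rewrite /B addr_ge0// divr_ge0 ?(ltW a10)// addr_ge0// !mulr_ge0 ?(ltW a20) ?(ltW K0).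
have [eps [eps0 epsK epsB epsa1]] := small_parameter a10 K0 B0.
pose V t := e t + eps * p t.
have Vlow t : 0 <= t -> e t / 2 <= V t /\ V t <= 3 / 2 * e t.
  move=> t0; have pe : `|p t| <= K * e t.
    apply: le_trans (pK t t0) _; rewrite -mulrA ler_pM2l// /e.
    by have := sqr_ge0 (r t - q t); nra.
  have pe2 : `|eps * p t| <= 2^-1 * e t.
    rewrite normrM gtr0_norm//; apply: le_trans (ler_wpM2l (ltW eps0) pe) _.
    by rewrite mulrA ler_wpM2r.
  by move: pe2; rewrite ler_norml /V; lra.
(* One has [V' <= - D / 2 - eps * q^2 / 2 <= - eps * e], and [V <= 3 / 2 * e] turns this into the
   rate [2 / 3 * eps]. *)
have Vdecay t : 0 <= t -> V t <= V 0 * expR (- (2 / 3 * eps) * t).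
  apply: (gronwall (f' := fun t => - D t + eps * (r t ^+ 2 - q t ^+ 2 - N t))).
  - move=> s s0; have := is_derive_lin eps (dp s s0) (de s s0).
    have -> : (fun x => eps * p x + (r x ^+ 2 + q x ^+ 2) / 2) = V.
      by apply/funext => x; rewrite /V addrC.
    by rewrite addrC.
  - by move=> s s0; apply: cvgD; [exact: ce|apply: cvgM; [exact: cvg_cst|exact: cp]].
  - move=> s s0; have [_ Vs] := Vlow s (ltW s0).
    have Ds := aD s s0; have Ns := NM s M s0 (qM s (ltW s0)).
    have D0 : 0 <= D s by apply: le_trans Ds; rewrite mulr_ge0 ?sqr_ge0// ltW.
    have amgm : 2 * a2 * (K * r s * q s) <=
        q s ^+ 2 / 2 + 2 * a2 ^+ 2 * K ^+ 2 * r s ^+ 2.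
      by have := sqr_ge0 (q s - 2 * a2 * K * r s); nra.
    have rD : (1 + 2 * a2 ^+ 2 * K ^+ 2) * r s ^+ 2 <=
        (1 + 2 * a2 ^+ 2 * K ^+ 2) / a1 * D s.
      rewrite -[leRHS]mulrA ler_wpM2l ?addr_ge0 ?mulr_ge0 ?(ltW a20) ?(ltW K0)//.
      by rewrite mulrC ler_pdivlMr// mulrC.
    have Nb : r s ^+ 2 - q s ^+ 2 - N s <= B * D s - q s ^+ 2 / 2.
      by move: Ns; rewrite ler_norml /B mulrDl; lra.
    have eB : eps * (B * D s) <= 2^-1 * D s by rewrite mulrA ler_wpM2r.
    have eN := ler_wpM2l (ltW eps0) Nb.
    have er : eps * r s ^+ 2 <= D s.
      by apply: le_trans Ds; rewrite ler_wpM2r// sqr_ge0.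
    have eV := ler_wpM2l (ltW eps0) Vs.
    by move: eV eN; rewrite /e !mulrBr !mulrDr; lra.
(* Both [r^2] and [q^2] are at most [2 e <= 4 V]; taking square roots halves the rate to [eps / 3],
   and the added 1 keeps [C] positive when [V 0 = 0]. *)
pose C := Num.sqrt (4 * V 0) + 1.
exists C, (eps / 3); split.
- by rewrite ltr_wpDl// sqrtr_ge0.
- by rewrite divr_gt0.
move=> t t0; have [Vt _] := Vlow t t0; have Vd := Vdecay t t0.
have Cb x : 0 <= x -> x ^+ 2 <= 2 * e t -> x <= C * expR (- (eps / 3) * t).
  move=> x0 xe.
  have h : x <= Num.sqrt (4 * V 0) * expR (- (eps / 3) * t).
    have V0 : 0 <= V 0.
      by have [V0 _] := Vlow 0 (lexx 0); apply: le_trans V0; rewrite divr_ge0.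
    rewrite -(@ler_pXn2r _ 2)// ?nnegrE ?mulr_ge0 ?sqrtr_ge0 ?expR_ge0//.
    rewrite exprMn sqr_sqrtr ?mulr_ge0// -expRM_natl.
    rewrite (_ : 2%:R * (- (eps / 3) * t) = - (2 / 3 * eps) * t); last by ring.
    by move: Vd Vt xe; rewrite -mulrA; lra.
  apply: le_trans h _; rewrite ler_wpM2r ?expR_ge0// /C lerDl//.
have h2 : e t * 2 = r t ^+ 2 + q t ^+ 2 by rewrite /e divfK.
by split; apply: Cb => //; have := sqr_ge0 (r t); have := sqr_ge0 (q t); lra.
Qed.

End Decay.

(** * The damping term and the energy *)

Section Nonlinearity.
Context {R : realType}.
Local Notation leb := (@lebesgue_measure R).
Local Notation measR := (@measurable _ (measurableTypeR R)).
Variables (m a1 a2 : R) (F : R -> R).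
Hypotheses (hm : 2 <= m) (ha1 : 0 < a1) (ha2 : 0 < a2) (hFsign : forall z : R, 0 <= F z * z).
Hypothesis hFbound : forall z : R,
  `|a1 * (z + `|z| `^ (m - 2) * z)| <= `|F z| /\
  `|F z| <= `|a2 * (z + `|z| `^ (m - 2) * z)|.

Let damping_normE (c z : R) : 0 < c ->
  `|c * (z + `|z| `^ (m - 2) * z)| = c * (1 + `|z| `^ (m - 2)) * `|z|.
Proof.
move=> c0; rewrite -{1}(mul1r z) -mulrDl mulrA normrM.
by rewrite ger0_norm// mulr_ge0 ?(ltW c0)// addr_ge0// powR_ge0.
Qed.

Lemma damping_normM z : `|F z| * `|z| = F z * z.
Proof. by rewrite -normrM ger0_norm. Qed.

Lemma damping_ge_sqr z : a1 * z ^+ 2 <= F z * z.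
Proof.
rewrite -damping_normM -(real_normK (num_real z)) expr2 mulrA ler_wpM2r//.
have [h _] := hFbound z; apply: le_trans h; rewrite damping_normE// ler_wpM2r//.
by rewrite ler_peMr ?(ltW ha1)// lerDl powR_ge0.
Qed.

(* For |z| <= 1 the damping is at most linear; for |z| > 1 one has
   |F z| <= F z * z, which absorbs the bound M on y. *)
Lemma damping_cross_le (z y M : R) : `|y| <= M ->
  `|F z * y| <= 2 * a2 * (`|z| * `|y|) + M * (F z * z).
Proof.
move=> yM; have M0 : 0 <= M by exact: le_trans yM.
rewrite normrM -damping_normM; have [z1|z1] := leP `|z| 1.
  apply: ler_wpDr; first by rewrite !mulr_ge0.
  rewrite mulrA ler_wpM2r//; have [_ h] := hFbound z; apply: le_trans h _.
  rewrite damping_normE// ler_wpM2r// mulrC ler_wpM2r ?(ltW ha2)//.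
  suff : `|z| `^ (m - 2) <= 1 by move: (_ `^ _) => p; lra.
  apply: (@le_trans _ _ (1 `^ (m - 2))); last by rewrite powR1.
  by apply: ge0_ler_powR; rewrite ?nnegrE// subr_ge0.
apply: ler_wpDl; first by rewrite !mulr_ge0// ltW.
rewrite mulrCA ler_wpM2l//; apply: le_trans yM _.
by rewrite ler_peMr// ltW.
Qed.

Variables (a b : R) (ab : a < b) (hFcont : continuous F).
Local Notation U := (`]a, b[%classic : set R).

Let mU : measR U. Proof. exact: measurable_itv. Qed.
Let phL2 : pre_hilbert (L2 U). Proof. exact: L2_pre_hilbert. Qed.

Lemma damping_dot_ge g : H2star U g ->
  a1 * norm (L2 U) g ^+ 2 <= dot (L2 U) (F \o g) g.
Proof.
move=> gH; have gL := H2star_L2 gH; have FgL := L2_comp ab hFcont gH.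
rewrite (sqr_norm phL2 gL) -(dotZl phL2 a1 gL gL).
have agL : L2 U (fun x => a1 * g x) by exact: (ph_scale phL2 a1 gL).
apply: le_Rintegral; [exact: mU|exact: L2_itgM|exact: L2_itgM|].
by move=> x _; rewrite -mulrA -expr2; exact: damping_ge_sqr.
Qed.

(** The pointwise splitting is integrated as it stands; Cauchy-Schwarz is applied only to [|g| |h|],
    so no norm of [F \o g] appears. *)
Lemma damping_dot_le g h (M : R) : H2star U g -> L2 U h ->
  {ae leb, forall x, U x -> `|h x| <= M} ->
  `|dot (L2 U) (F \o g) h| <=
  2 * a2 * (norm (L2 U) g * norm (L2 U) h) + M * dot (L2 U) (F \o g) g.
Proof.
move=> gH hL hM; have gL := H2star_L2 gH; have FgL := L2_comp ab hFcont gH.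
have i1 := L2_itgM mU FgL hL; have i2 := L2_itgM mU FgL gL.
have gnL := L2_normr mU gL; have hnL := L2_normr mU hL.
have i3 := L2_itgM mU gnL hnL.
have i4 := itgZ (2 * a2) mU i3; have i5 := itgZ M mU i2.
apply: le_trans (le_normr_Rintegral mU i1) _.
apply: (@le_trans _ _ (2 * a2 * dot (L2 U) (fun x => `|g x|) (fun x => `|h x|) +
    M * dot (L2 U) (F \o g) g)).
  rewrite -(RintegralZl (2 * a2) mU i3) -(RintegralZl M mU i2) -(RintegralD mU i4 i5).
  apply: le_Rintegral_ae; [exact: mU|exact: itg_norm|exact: itgD|].
  by apply: filterS hM => x /= h1 Ux; exact: damping_cross_le (h1 Ux).
rewrite lerD2r ler_wpM2l ?mulr_ge0 ?(ltW ha2)//.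
have := le_trans (ler_norm _) (cauchy_schwarz phL2 gnL hnL).
by rewrite !norm_normr.
Qed.

End Nonlinearity.

(** * Time derivatives of the energy and of the cross term *)

Section EnergyIdentity.
Context {R : realType}.
Variables (a b : R) (ab : a < b).
Local Notation U := (`]a, b[%classic : set R).
Local Notation measR := (@measurable _ (measurableTypeR R)).

Let mU : measR U. Proof. exact: measurable_itv. Qed.
Let phL2 : pre_hilbert (L2 U). Proof. exact: L2_pre_hilbert. Qed.
Let phH2 : pre_hilbert (H2star U). Proof. exact: H2star_pre_hilbert. Qed.

Lemma sqr_norm_L2 (f : R -> R) : norm (L2 U) f ^+ 2 = dot (L2 U) f f.
Proof.
by rewrite sqr_sqrtr//; apply: Rintegral_ge0 => x _; rewrite -expr2 sqr_ge0.
Qed.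

Lemma sqr_norm_H2star (f : R -> R) : norm (H2star U) f ^+ 2 = dot (H2star U) f f.
Proof. exact: sqr_norm_L2. Qed.

Lemma cvg_dot_C0 (X : ip_space) (u v : R -> R -> R) (t : R) : pre_hilbert X ->
  C0 X u -> C0 X v -> 0 <= t ->
  dot X (u s) (v s) @[s --> within [set s | 0 <= s] (nbhs t)] --> dot X (u t) (v t).
Proof.
move=> phX cu cv t0; have [uX cut] := cu t t0; have [vX cvt] := cv t t0.
have nA : \forall s \near within [set s : R | 0 <= s] (nbhs t), 0 <= s.
  exact: withinT.
apply: (cvg_dot phX uX vX _ _ cut cvt).
  by apply: filterS nA => s /cu[].
by apply: filterS nA => s /cv[].
Qed.

Lemma is_derive_dot (X : ip_space) (u v u' v' : R -> R -> R) (t : R) : pre_hilbert X ->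
  (forall s : R, 0 <= s -> X (u s)) -> (forall s : R, 0 <= s -> X (v s)) -> 0 < t ->
  has_derivative X u t (u' t) -> has_derivative X v t (v' t) ->
  is_derive t (1 : R) (fun s => dot X (u s) (v s))
    (dot X (u' t) (v t) + dot X (u t) (v' t)).
Proof.
move=> phX uX vX t0 du dv; apply: is_derive_quotient => //.
exact: (has_derivative_dot phX (ltW t0) uX vX du dv).
Qed.

Variables (F : R -> R) (u v w : R -> R -> R).
Hypothesis hev : evolution a b u v w.
Hypothesis heq : forall (t : R) (z : R -> R), 0 < t -> L2 U z ->
  dot (L2 U) (w t) z = - (dot (L2 U) (L U (u t)) z + dot (L2 U) (F \o v t) z).

Let uH4 (t : R) : 0 <= t -> H4star U (u t).
Proof. by move=> /(ev_H4 hev)[]. Qed.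

Let uH (t : R) : 0 <= t -> H2star U (u t).
Proof. by move=> /(ev_H2 hev)[]. Qed.

Let vH (t : R) : 0 <= t -> H2star U (v t).
Proof. by move=> /(ev_v hev)[]. Qed.

Let wL (t : R) : 0 <= t -> L2 U (w t).
Proof. by move=> /(ev_w hev)[]. Qed.

(** The equation is used with [z = v t]. By [L_dot], which requires [v t] in [H2star], the elastic
    term cancels the derivative of the bending energy. *)
Lemma energy_derive (t : R) : 0 < t ->
  is_derive t (1 : R)
    (fun s => (norm (L2 U) (v s) ^+ 2 + norm (H2star U) (u s) ^+ 2) / 2)
    (- dot (L2 U) (F \o v t) (v t)).
Proof.
move=> t0; have tt := ltW t0.
have vL (s : R) : 0 <= s -> L2 U (v s) by move=> s0; exact: H2star_L2 (vH s0).
have dA := is_derive_dot phL2 vL vL t0 (ev_dv hev tt) (ev_dv hev tt).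
have dB := is_derive_dot phH2 uH uH t0 (ev_du hev tt) (ev_du hev tt).
have := is_derive_lin 2^-1 (is_derive_lin 1 dA dB) (is_derive_cst 0 t 1).
have -> : (fun s => 2^-1 * (1 * dot (L2 U) (v s) (v s) + dot (H2star U) (u s) (u s))
    + cst 0 s) = (fun s => (norm (L2 U) (v s) ^+ 2 + norm (H2star U) (u s) ^+ 2) / 2).
  apply/funext => s; rewrite sqr_norm_L2 sqr_norm_H2star.
  by move: (dot _ _ _) (dot _ _ _) => x y /=; ring.
move=> h; apply: (is_derive_eq h).
rewrite (ph_sym phL2 (vL t tt) (wL tt)) (ph_sym phH2 (uH tt) (vH tt)).
rewrite (heq t0 (vL t tt)) (L_dot ab (uH4 tt) (vH tt)) (ph_sym phH2 (uH tt) (vH tt)).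
by move: (dot _ _ _) (dot _ _ _) => x y; field.
Qed.

(** The equation is used with [z = u t]; the [H2star] derivative of [u] is first read as an L^2
    derivative, since the product is taken in [L2]. *)
Lemma cross_derive (t : R) : 0 < t ->
  is_derive t (1 : R) (fun s => dot (L2 U) (v s) (u s))
    (norm (L2 U) (v t) ^+ 2 - norm (H2star U) (u t) ^+ 2 - dot (L2 U) (F \o v t) (u t)).
Proof.
move=> t0; have tt := ltW t0.
have vL (s : R) : 0 <= s -> L2 U (v s) by move=> s0; exact: H2star_L2 (vH s0).
have uL (s : R) : 0 <= s -> L2 U (u s) by move=> s0; exact: H2star_L2 (uH s0).
have duL := H2star_has_derivative_L2 ab tt uH (ev_du hev tt).
have h := is_derive_dot phL2 vL uL t0 (ev_dv hev tt) duL.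
apply: (is_derive_eq h); rewrite sqr_norm_L2 sqr_norm_H2star.
rewrite (heq t0 (uL t tt)) (L_dot ab (uH4 tt) (uH tt)).
by move: (dot _ _ _) (dot _ _ _) (dot _ _ _) => x y z; ring.
Qed.

Lemma energy_cvg (t : R) : 0 <= t ->
  (norm (L2 U) (v s) ^+ 2 + norm (H2star U) (u s) ^+ 2) / 2
    @[s --> within [set s | 0 <= s] (nbhs t)] -->
  (norm (L2 U) (v t) ^+ 2 + norm (H2star U) (u t) ^+ 2) / 2.
Proof.
move=> t0; have cvL := C0_H2star_L2 ab (ev_v hev).
under eq_fun do rewrite sqr_norm_L2 sqr_norm_H2star.
rewrite sqr_norm_L2 sqr_norm_H2star; apply: cvgM; last exact: cvg_cst.
by apply: cvgD; apply: cvg_dot_C0 => //; exact: ev_H2 hev.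
Qed.

Lemma cross_cvg (t : R) : 0 <= t ->
  dot (L2 U) (v s) (u s) @[s --> within [set s | 0 <= s] (nbhs t)] -->
  dot (L2 U) (v t) (u t).
Proof.
move=> t0; apply: cvg_dot_C0 => //; first exact: (C0_H2star_L2 ab (ev_v hev)).
exact: (C0_H2star_L2 ab (ev_H2 hev)).
Qed.

End EnergyIdentity.

Theorem theorem1p1 (R : realType) (a b : R) (hab : a < b)
    (m : R) (hm : 2 <= m)
    (a1 a2 : R) (ha1 : 0 < a1) (ha2 : 0 < a2) (ha12 : a1 <= a2)
    (f : R -> R -> R) (hf : C0 (L2 `]a, b[) f)
    (hf0 : forall t : R, 0 <= t -> ae_eq_on `]a, b[ (f t) (cst 0))
    (F : R -> R) (hFcont : continuous F)
    (hFsign : forall z : R, 0 <= F z * z)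
    (hFbound : forall z : R,
      `|a1 * (z + `|z| `^ (m - 2) * z)| <= `|F z| /\
      `|F z| <= `|a2 * (z + `|z| `^ (m - 2) * z)|)
    (G : R -> R) (hG : forall z : R, G z = 0)
    (u0 u1 : R -> R) (hu0 : H4star `]a, b[ u0) (hu1 : H2star `]a, b[ u1)
    (u : R -> R -> R)
    (hu : unique_pseudo_classical_solution `]a, b[ F G f u0 u1 u) :
  exponential_decay (fun t => norm (H2star `]a, b[) (u t)) /\
  exponential_decay (fun t => norm (L2 `]a, b[) (Dt `]a, b[ u t)).
Proof.
case: hu => sol _.
have mU : @measurable _ (measurableTypeR R) `]a, b[ by exact: measurable_itv.
have [v [w [hev Dvw]]] := solution_evolution hab sol.
have heq t z (t0 : 0 < t) (zL : L2 `]a, b[ z) :=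
  solution_pointwise hab hFcont hG hf hf0 sol hev Dvw zL t0.
have vH (t : R) : 0 <= t -> H2star `]a, b[ (v t) by move=> /(ev_v hev)[].
have uH (t : R) : 0 <= t -> H2star `]a, b[ (u t) by move=> /(ev_H2 hev)[].
have phL2 := L2_pre_hilbert mU.
have [K K0 HK] := H2star_embedding hab.
have cross_le (t : R) : 0 <= t -> `|dot (L2 `]a, b[) (v t) (u t)| <=
    K * norm (L2 `]a, b[) (v t) * norm (H2star `]a, b[) (u t).
  move=> t0; have [_ uK] := HK _ (uH t t0).
  apply: le_trans (cauchy_schwarz phL2 (H2star_L2 (vH t t0)) (H2star_L2 (uH t t0))) _.
  by rewrite mulrAC [leRHS]mulrC ler_wpM2l// ph_norm_ge0.
have damping_le (t M : R) : 0 < t -> K * norm (H2star `]a, b[) (u t) <= M ->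
    `|dot (L2 `]a, b[) (F \o v t) (u t)| <=
    2 * a2 * (K * norm (L2 `]a, b[) (v t) * norm (H2star `]a, b[) (u t)) +
    M * dot (L2 `]a, b[) (F \o v t) (v t).
  move=> t0 qM; have [usup uK] := HK _ (uH t (ltW t0)).
  have usup' : {ae lebesgue_measure, forall x, `]a, b[%classic x -> `|u t x| <= M}.
    by apply: filterS usup => x /= h Ux; apply: le_trans (h Ux) qM.
  apply: le_trans (damping_dot_le hm ha2 hFsign hFbound hab hFcont (vH t (ltW t0))
    (H2star_L2 (uH t (ltW t0))) usup') _.
  rewrite lerD2r ler_wpM2l ?mulr_ge0 ?(ltW ha2)//.
  by rewrite mulrAC [leRHS]mulrC ler_wpM2l// ph_norm_ge0.
have [C [c [C0 c0 decay]]] := perturbed_energy_decay ha1 ha2 K0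
  (fun t => ph_norm_ge0 (v t)) (fun t => ph_norm_ge0 (u t))
  (energy_derive hab hev heq) (cross_derive hab hev heq)
  (energy_cvg hab hev) (cross_cvg hab hev)
  (fun t t0 => damping_dot_ge ha1 hFsign hFbound hab hFcont (vH t (ltW t0)))
  cross_le damping_le.
split; exists C, c; split => // t t0; first by case: (decay t t0).
(* The decay was obtained for the representative [v]; the L^2 norm does not distinguish it from
   [Dt]. *)
have [[DL Dv] _] := Dvw t t0.
rewrite (ae_eq_norm DL (H2star_L2 (vH t t0)) Dv).
by case: (decay t t0).
Qed.
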